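(* Let $\overline g_{ab}=\widetilde g_{ab}+\Phi_{ab}$ be the modified Patterson–Walker metric associated to a special torsion-free affine connection $D_A$ and $\Phi_{AB}\in\mathcal{E}_{(AB)}(2)$. A section $\sigma\in\widetilde{\mathcal{E}}[1]$ is an almost Einstein scale of the modified conformal extension represented by $\overline g_{ab}$ if and only if $\sigma$ is linear in $p_A$, $$\sigma=\xi^Rp_R+\tau,$$ and the underlying sections $\tau\in\mathcal{E}(1)$ and $\xi^A\in\mathcal{E}^A(-1)$ satisfy the integrability condition $$\xi^RW_{RB}{}^C{}_D=0$$ and the differential conditions $$(D_A\xi^B)_0=0,\qquad (D_AD_B+\mathrm{P}_{AB})\tau=\mathcal{F}(\xi,\Phi)_{AB}.$$
   Context: $M$ is an oriented manifold of dimension $n\ge 2$. Abstract indices $A,B,\dots$ refer to $M$; round/square brackets denote symmetrization/skew-symmetrization; $(\cdot)_0$ is the trace-free part. $\mathcal{E}(w)=(\Lambda^nTM)^{w/(n+1)}$ is the bundle of densities of projective weight $w$; $\mathcal{E}^A(w)=\mathcal{E}^A\otimes\mathcal{E}(w)$, etc. (same symbols for spaces of sections). A torsion-free connection is special if it preserves a volume form; this trivializes all $\mathcal{E}(w)$. Curvature: $(D_AD_B-D_BD_A)v^C=R_{AB}{}^C{}_Dv^D$; $\mathrm{Ric}_{BD}=R_{AB}{}^A{}_D$; $\mathrm{P}_{AB}=\frac1{n-1}\mathrm{Ric}_{AB}$; $W_{AB}{}^C{}_D=R_{AB}{}^C{}_D+\mathrm{P}_{AD}\delta^C_B-\mathrm{P}_{BD}\delta^C_A$.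 Operator: $\mathcal{F}(\xi,\Phi)_{AB}=\xi^R\big(D_{(A}\Phi_{B)R}-\frac12D_R\Phi_{AB}\big)+\frac1n(D_R\xi^R)\Phi_{AB}$. Modified PW metric: let $\pi:\widetilde M\to M$, $\widetilde M=T^*M\otimes\mathcal{E}(2)$, identified with $T^*M$ by the $D$-parallel volume form, with coordinates $(x^A)$ on $M$ and canonical fibre coordinates $(p_A)$ ($p_A$ is the tautological section of $\pi^*\mathcal{E}_A(2)$). $T\widetilde M=V\oplus H$ with $V\cong\pi^*T^*M$ vertical, $H\cong\pi^*TM$ the horizontal distribution of $D$. $\widetilde g$ is the split-signature metric making $V$ and $H$ isotropic and pairing them naturally; in coordinates $\widetilde g=2\,dx^A\odot dp_A-2\Gamma_A{}^C{}_Bp_C\,dx^A\odot dx^B$ with $a\odot b=\frac12(a\otimes b+b\otimes a)$. $\Phi_{ab}=\pi^*\Phi$ and $\overline g=\widetilde g+\pi^*\Phi$; its conformal class is the modified conformal extension of the projective class of $D$ associated to $\Phi$. $\widetilde{\mathcal{E}}[w]=(\Lambda^{2n}T\widetilde M)^{w/(2n)}$ is canonically isomorphic to $\pi^*\mathcal{E}(w)$, so $\xi^Rp_R+\tau$ is a section of $\widetilde{\mathcal{E}}[1]$ (in the trivializations given by $D$ and $\overline g$, all densities are functions). A section $\sigma$ of $\widetilde{\mathcal{E}}[1]$ is an almost Einstein scale if $\sigma^{-2}\overline g$ is Einstein off the zero set of $\sigma$; equivalently, the trace-free part (w.r.t. $\overline g$) of $(\overline D_a\overline D_b+\overline{\mathrm{P}}_{ab})\sigma$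 vanishes, where $\overline D$, $\overline{\mathrm{P}}$ are the Levi-Civita connection and Schouten tensor of $\overline g$. *)

(* Defs.v *)
From HB Require Import structures.
From mathcomp Require Import all_boot all_order all_algebra.
From mathcomp Require Import all_classical all_reals all_analysis.
Set Implicit Arguments.
Unset Strict Implicit.
Unset Printing Implicit Defensive.
Import Order.TTheory GRing.Theory Num.Theory.
Import numFieldNormedType.Exports.
Local Open Scope classical_set_scope.
Local Open Scope ring_scope.

(* Conventions.  Everything is expressed by components in charts.  A vector   *)
(* field is a row vector v, v 0 A = v^A; a covector is a row vector p,        *)
(* p 0 A = p_A; a covariant 2-tensor is a matrix t, t A B = t_AB.             *)

Section LocalCalculus.
Context {R : realType} {m : nat}.
Implicit Types (U : set 'rV[R]_m) (f : 'rV[R]_m -> R) (x : 'rV[R]_m).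

Definition pd (A : 'I_m) f x : R := 'D_(delta_mx 0 A : 'rV[R]_m) f x.

Fixpoint Ck (k : nat) U f : Prop :=
  (forall x, U x -> {for x, continuous f}) /\
  (if k is k'.+1 then
     forall A : 'I_m,
       (forall x, U x -> derivable f x (delta_mx 0 A : 'rV[R]_m)) /\
       Ck k' U (pd A f)
   else True).

(* C^oo on the (open) set U *)
Definition smooth U f : Prop := forall k, Ck k U f.

(* G x A C B is the coefficient Gamma_A^C_B at x:                             *)
(* D_(d/dx^A) (d/dx^B) = Gamma_A^C_B d/dx^C                                   *)
Definition christoffel := 'rV[R]_m -> 'I_m -> 'I_m -> 'I_m -> R.
Implicit Types G : christoffel.

(* D_A v^B *)
Definition nabla_vec G (v : 'rV[R]_m -> 'rV[R]_m) x (A B : 'I_m) : R :=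
  pd A (fun y => v y 0 B) x + \sum_C G x A B C * v x 0 C.

(* D_A w_B *)
Definition nabla_covec G (w : 'rV[R]_m -> 'rV[R]_m) x (A B : 'I_m) : R :=
  pd A (fun y => w y 0 B) x - \sum_C G x A C B * w x 0 C.

(* D_A t_BC *)
Definition nabla_cotensor2 G (t : 'rV[R]_m -> 'M[R]_m) x (A B C : 'I_m) : R :=
  pd A (fun y => t y B C) x
  - \sum_E G x A E B * t x E C - \sum_E G x A E C * t x B E.

(* D_A D_B f *)
Definition hessian G f x (A B : 'I_m) : R :=
  nabla_covec G (fun y => \row_C pd C f y) x A B.

(* R_AB^C_E, where (D_A D_B - D_B D_A) v^C = R_AB^C_E v^E *)
Definition curvature G x (A B C E : 'I_m) : R :=
  pd A (fun y => G y B C E) x - pd B (fun y => G y A C E) x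
  + \sum_K (G x A C K * G x B K E - G x B C K * G x A K E).

(* Ric_BE = R_AB^A_E *)
Definition ricci G x (B E : 'I_m) : R := \sum_A curvature G x A B A E.

Definition proj_schouten G x (A B : 'I_m) : R := ricci G x A B / (m%:R - 1).

(* W_AB^C_E *)
Definition proj_weyl G x (A B C E : 'I_m) : R :=
  curvature G x A B C E
  + proj_schouten G x A E * (C == B)%:R - proj_schouten G x B E * (C == A)%:R.

Definition levi_civita (g : 'rV[R]_m -> 'M[R]_m) : christoffel :=
  fun x A C B =>
    2^-1 * \sum_E invmx (g x) C E *
      (pd A (fun y => g y B E) x + pd B (fun y => g y A E) x
       - pd E (fun y => g y A B) x).

Definition scalar_curvature (g : 'rV[R]_m -> 'M[R]_m) x : R :=
  \sum_A \sum_B invmx (g x) A B * ricci (levi_civita g) x A B.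

(* The trace-free part of Ric vanishes on U; in dimension m >= 3, which is    *)
(* the case of use, the Einstein factor is then locally constant.             *)
Definition einstein_on U (g : 'rV[R]_m -> 'M[R]_m) : Prop :=
  forall x, U x -> forall A B : 'I_m,
    ricci (levi_civita g) x A B - scalar_curvature g x / m%:R * g x A B = 0.

(* F(xi,Phi)_AB =                                                             *)
(*   xi^K (D_(A Phi_B)K - 1/2 D_K Phi_AB) + 1/m (D_K xi^K) Phi_AB             *)
Definition operF G (xi : 'rV[R]_m -> 'rV[R]_m) (Phi : 'rV[R]_m -> 'M[R]_m)
    x (A B : 'I_m) : R :=
  \sum_K xi x 0 K *
    ((nabla_cotensor2 G Phi x A B K + nabla_cotensor2 G Phi x B A K) / 2
     - 2^-1 * nabla_cotensor2 G Phi x K A B)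
  + m%:R^-1 * (\sum_K nabla_vec G xi x K K) * Phi x A B.

(* (D_A xi^B)_0 *)
Definition tracefree_nabla_vec G (xi : 'rV[R]_m -> 'rV[R]_m) x (A B : 'I_m)
    : R :=
  nabla_vec G xi x A B
  - m%:R^-1 * (\sum_K nabla_vec G xi x K K) * (A == B)%:R.

End LocalCalculus.

Arguments christoffel : clear implicits.

Definition smooth_vmap {R : realType} {m p : nat} (U : set 'rV[R]_m)
    (f : 'rV[R]_m -> 'rV[R]_p) : Prop :=
  forall k : 'I_p, smooth U (fun x => f x 0 k).

(* partial derivatives d y^B / d x^A of y = f x *)
Definition jacobi_mx {R : realType} {m : nat} (f : 'rV[R]_m -> 'rV[R]_m)
    (x : 'rV[R]_m) : 'M[R]_m :=
  \matrix_(A, B) pd A (fun y => f y 0 B) x.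

(* Smooth oriented manifolds (Hausdorff, second countable), given by an       *)
(* oriented atlas.  chart i is only meaningful on the open set chart_dom i,   *)
(* and chart_inv i on the image of chart_dom i under chart i.                 *)
Record oriented_manifold (R : realType) (n : nat) := OrientedManifold {
  mspace :> topologicalType;
  mspace_hausdorff : hausdorff_space mspace;
  mspace_second_countable : @second_countable mspace;
  chart_idx : Type;
  chart_dom : chart_idx -> set mspace;
  chart : chart_idx -> mspace -> 'rV[R]_n;
  chart_inv : chart_idx -> 'rV[R]_n -> mspace;
  chart_cover : forall a : mspace, exists i, chart_dom i a;
  chart_dom_open : forall i, open (chart_dom i);
  chart_img_open : forall i, open (chart i @` chart_dom i);
  chartK : forall i a, chart_dom i a -> chart_inv i (chart i a) = a;
  chart_continuous : forall i a, chart_dom i a -> {for a, continuous (chart i)};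
  chart_inv_continuous : forall i x, (chart i @` chart_dom i) x ->
    {for x, continuous (chart_inv i)};
  chart_smooth : forall i j,
    smooth_vmap (chart i @` (chart_dom i `&` chart_dom j))
      (chart j \o chart_inv i);
  chart_oriented : forall i j x,
    (chart i @` (chart_dom i `&` chart_dom j)) x ->
    0 < \det (jacobi_mx (chart j \o chart_inv i) x)
}.

Section Manifold.
Context {R : realType} {n : nat} (M : oriented_manifold R n).
Local Notation idx := (chart_idx M).

Definition chart_img (i : idx) : set 'rV[R]_n := chart i @` chart_dom i.

Definition overlap (i j : idx) : set 'rV[R]_n :=
  chart i @` (chart_dom i `&` chart_dom j).

Definition transition (i j : idx) : 'rV[R]_n -> 'rV[R]_n :=
  chart j \o chart_inv i.

Definition transJ (i j : idx) : 'rV[R]_n -> 'M[R]_n :=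
  jacobi_mx (transition i j).

(* Densities are functions here: a D-parallel volume form trivializes all     *)
(* E(w), and the induced covariant derivative is that of functions.           *)
(* Fields are families of local expressions, smooth on the chart images and   *)
(* obeying the transformation law on overlaps.                                *)

Record scalar_field := ScalarField {
  scal_loc :> idx -> 'rV[R]_n -> R;
  scal_smooth : forall i, smooth (chart_img i) (scal_loc i);
  scal_compat : forall i j x, overlap i j x ->
    scal_loc i x = scal_loc j (transition i j x)
}.

Record vector_field := VectorField {
  vec_loc :> idx -> 'rV[R]_n -> 'rV[R]_n;
  vec_smooth : forall i, smooth_vmap (chart_img i) (vec_loc i);
  vec_compat : forall i j x, overlap i j x ->
    vec_loc j (transition i j x) = vec_loc i x *m transJ i j x
}.

(* sections of E_(AB) *)
Record sym_cotensor2 := SymCotensor2 {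
  cot2_loc :> idx -> 'rV[R]_n -> 'M[R]_n;
  cot2_smooth : forall i A B, smooth (chart_img i) (fun x => cot2_loc i x A B);
  cot2_sym : forall i x, chart_img i x -> (cot2_loc i x)^T = cot2_loc i x;
  cot2_compat : forall i j x, overlap i j x ->
    cot2_loc i x =
      transJ i j x *m cot2_loc j (transition i j x) *m (transJ i j x)^T
}.

(* nowhere vanishing n-forms vol_loc i x dx^1 /\ ... /\ dx^n *)
Record volume_form := VolumeForm {
  vol_loc :> idx -> 'rV[R]_n -> R;
  vol_smooth : forall i, smooth (chart_img i) (vol_loc i);
  vol_neq0 : forall i x, chart_img i x -> vol_loc i x != 0;
  vol_compat : forall i j x, overlap i j x ->
    vol_loc i x = \det (transJ i j x) * vol_loc j (transition i j x)
}.

Record affine_connection := AffineConnection {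
  conn_loc :> idx -> christoffel R n;
  conn_smooth : forall i A C B,
    smooth (chart_img i) (fun x => conn_loc i x A C B);
  conn_compat : forall i j x, overlap i j x -> forall A B E : 'I_n,
    \sum_C conn_loc i x A C B * transJ i j x C E =
      pd A (fun y => transJ i j y B E) x
      + \sum_C \sum_K transJ i j x A C * transJ i j x B K *
          conn_loc j (transition i j x) C E K
}.

Definition torsion_free (D : affine_connection) : Prop :=
  forall i x, chart_img i x -> forall A C B : 'I_n, D i x A C B = D i x B C A.

Definition parallel (D : affine_connection) (vol : volume_form) : Prop :=
  forall i x, chart_img i x -> forall A : 'I_n,
    pd A (vol i) x - (\sum_B D i x A B B) * vol i x = 0.

Definition special (D : affine_connection) : Prop :=
  exists vol : volume_form, parallel D vol.

(* The total space of T^*M is covered by the charts z = row_mx x p of         *)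
(* 'rV_(n + n), x in chart_img i and p arbitrary, where p stands for the      *)
(* covector p_A dx^A.                                                         *)
Definition cotangent_img (i : idx) : set 'rV[R]_(n + n) :=
  [set z | chart_img i (lsubmx z)].

(* Smooth functions on T^*M; if x' = transition i j x, then q_B dx'^B is      *)
(* the covector with components (q *m J^T)_A = q_B dx'^B/dx^A in chart i.     *)
Record cotangent_function := CotangentFunction {
  cotf_loc :> idx -> 'rV[R]_(n + n) -> R;
  cotf_smooth : forall i, smooth (cotangent_img i) (cotf_loc i);
  cotf_compat : forall i j x q, overlap i j x ->
    cotf_loc i (row_mx x (q *m (transJ i j x)^T)) =
      cotf_loc j (row_mx (transition i j x) q)
}.

(* Patterson-Walker metric                                                    *)
(*   2 dx^A (.) dp_A - 2 Gamma_A^C_B p_C dx^A (.) dx^B,                       *)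
(* with a (.) b = 1/2 (a (x) b + b (x) a), and its modification by Phi        *)
Definition pw_metric (D : affine_connection) (i : idx)
    (z : 'rV[R]_(n + n)) : 'M[R]_(n + n) :=
  block_mx
    (\matrix_(A, B) (- 2 * \sum_C D i (lsubmx z) A C B * rsubmx z 0 C)) 1%:M
    1%:M 0.

Definition modified_pw_metric (D : affine_connection) (Phi : sym_cotensor2)
    (i : idx) (z : 'rV[R]_(n + n)) : 'M[R]_(n + n) :=
  pw_metric D i z + block_mx (Phi i (lsubmx z)) 0 0 0.

(* sigma is a density of conformal weight 1, written as a function in the     *)
(* trivialization given by g, so that sigma^-2 g is an honest metric off the  *)
(* zero set of sigma.                                                         *)
Definition almost_einstein_scale (g : idx -> 'rV[R]_(n + n) -> 'M[R]_(n + n))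
    (sigma : cotangent_function) : Prop :=
  forall i,
    einstein_on (cotangent_img i `&` [set z | sigma i z != 0])
      (fun z => (sigma i z) ^- 2 *: g i z).

End Manifold.

(* Main.v *)
Require Import Defs.
From mathcomp Require Import all_boot all_order all_algebra.
From mathcomp Require Import all_classical all_reals all_analysis.
From mathcomp Require Import ring.
Set Implicit Arguments.
Unset Strict Implicit.
Unset Printing Implicit Defensive.
Import Order.TTheory GRing.Theory Num.Theory.
Import numFieldNormedType.Exports.
Local Open Scope classical_set_scope.
Local Open Scope ring_scope.

(** The almost Einstein condition is first made linear. Under g |-> s^-2 g in
    dimension m the trace-free Ricci tensor changes by (m - 2) / s times the
    trace-free Hessian of s ([ricci_conformal]), so off its zeros a scale s is
    Einstein iff Hess s + s Ric / (m - 2) is a multiple of g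
    ([einstein_conformalP]). For smooth s this then holds on the zero set too
    ([einstein_equation_closure]): where it failed, s would vanish on an open
    set.

    For the modified Patterson-Walker metric, with base coordinates x^A and
    momenta p_A, the Levi-Civita connection is computed block by block. Its
    Ricci tensor has only a horizontal part, twice the symmetrized Ricci tensor
    of D ([mpw_ricci_xx]); a parallel volume makes the latter symmetric
    ([ricci_sym_of_parallel]), so Ric / (2n - 2) is the projective Schouten
    tensor P. The linear equation splits into three groups of components.

    - Vertical: the second fibre derivatives of sigma vanish, so
      sigma = xi^R p_R + tau ([einstein_equation_fibre_affine]).
    - Mixed: D_A xi^B = lam delta_A^B, which determines lam as the divergence
      of xi divided by n and is the equation (D_A xi^B)_0 = 0.
    - Horizontal: an expression affine in p ([hessian_affine_xx]). Its value at
      p = 0 is (D_A D_B + P_AB) tau - F(xi, Phi)_AB, the operator F arising from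
      the Christoffel symbols of Phi and from lam Phi. The coefficient of p_K is
      second order in xi; the Ricci identity gives D_B lam = - P_BC xi^C
      ([pd_trace_factor]), and after elimination the coefficient is
      - xi^C W_CB^K_A ([momentum_coefE]).

    An affine function of p vanishes identically iff its coefficients do, which
    gives the equivalence in a chart ([einstein_affineP]). Globally, xi and tau
    are the fibre derivative and the value of sigma along the zero section; the
    behaviour of sigma under changes of charts yields theirs. *)

(** * Partial derivatives of smooth functions *)

Section Deltas.
Context {R : realType} {m : nat}.
Implicit Types (F : 'I_m -> R).

Lemma sum_delta F j : \sum_i (i == j)%:R * F i = F j.
Proof.
rewrite (bigD1 j) //= eqxx mul1r big1 ?addr0 // => i /negPf ->.
by rewrite mul0r.
Qed.

Lemma sum_delta_sym F j : \sum_i (j == i)%:R * F i = F j.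
Proof. by under eq_bigr do rewrite eq_sym; exact: sum_delta. Qed.

End Deltas.

Section Calculus.
Context {R : realType} {m : nat}.
Implicit Types (U V : set 'rV[R]_m) (f g : 'rV[R]_m -> R) (x : 'rV[R]_m).

Local Notation e A := (delta_mx 0 A : 'rV[R]_m).

Lemma eq_near_pd A f g x : (\near x, f x = g x) -> pd A f x = pd A g x.
Proof. exact: near_eq_derive. Qed.

Lemma eq_on_open_pd U A f g x : open U -> U x ->
  (forall y, U y -> f y = g y) -> pd A f x = pd A g x.
Proof.
move=> oU Ux fg; apply: eq_near_pd.
by near do apply: fg; exact: open_nbhs_nbhs.
Unshelve. all: by end_near. Qed.

Lemma eq_on_open_continuous U f g x : open U -> U x ->
  (forall y, U y -> f y = g y) -> {for x, continuous f} ->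
  {for x, continuous g}.
Proof.
move=> oU Ux fg cf.
have cf' : f @ x --> f x by [].
have : g @ x --> g x; last by [].
rewrite -(fg x Ux).
apply: cvg_trans (@near_eq_cvg _ _ (nbhs x) _ f g _) cf'.
have nU : nbhs x U by exact: open_nbhs_nbhs.
by apply: filterS nU => y Uy; rewrite fg.
Qed.

Lemma eq_Ck k U f g : open U -> (forall y, U y -> f y = g y) ->
  Ck k U f -> Ck k U g.
Proof.
move=> oU; elim: k f g => [|k IH] f g fg /= [cf df].
  by split=> // x Ux; exact: eq_on_open_continuous oU Ux fg (cf x Ux).
split=> [x Ux|A]; first exact: eq_on_open_continuous oU Ux fg (cf x Ux).
have [dfA CfA] := df A; split.
  move=> x Ux; apply: near_eq_derivable (dfA x Ux).
  by near do apply: fg; exact: open_nbhs_nbhs.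
by apply: IH CfA => y Uy; exact: eq_on_open_pd oU Uy fg.
Unshelve. all: by end_near. Qed.

Lemma eq_smooth U f g : open U -> (forall y, U y -> f y = g y) ->
  smooth U f -> smooth U g.
Proof. by move=> oU fg sf k; apply: eq_Ck oU fg (sf k). Qed.

Lemma sub_smooth U V f : V `<=` U -> smooth U f -> smooth V f.
Proof.
move=> VU sf k; have {sf} := sf k.
elim: k f => [|k IH] f /= [cf df]; first by split=> // x /VU; exact: cf.
split=> [x /VU|A]; first exact: cf.
by have [dA CA] := df A; split; [move=> x /VU; exact: dA|exact: IH].
Qed.

Lemma smooth_continuous U f x : smooth U f -> U x -> {for x, continuous f}.
Proof. by move=> sf Ux; have [c _] := sf 0%N; exact: c. Qed.

Lemma smooth_derivable U f x A : smooth U f -> U x -> derivable f x (e A).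
Proof. by move=> sf Ux; have [_ /(_ A)[d _]] := sf 1%N; exact: d. Qed.

Lemma smooth_pd U f A : smooth U f -> smooth U (pd A f).
Proof. by move=> sf k; have [_ /(_ A)[_]] := sf k.+1. Qed.

Lemma CkW k U f : Ck k.+1 U f -> Ck k U f.
Proof.
elim: k f => [|k IH] f; first by case.
move=> [cf df]; split=> // A; have [dA CA] := df A; split=> //.
exact: IH.
Qed.

Section Pointwise.
Context (U : set 'rV[R]_m) (oU : open U).

Lemma Ck_cst k c : Ck k U (fun=> c).
Proof.
elim: k c => [|k IH] c; first by split=> // x _; exact: cst_continuous.
split=> [x _|A]; first exact: cst_continuous.
split=> [x _|]; first exact: derivable_cst.
rewrite [pd A _](_ : _ = fun=> 0) //.
by apply/funext => x; rewrite /pd derive_cst.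
Qed.

Lemma CkD k f g : Ck k U f -> Ck k U g -> Ck k U (fun x => f x + g x).
Proof.
elim: k f g => [|k IH] f g [cf df] [cg dg].
  by split=> // x Ux; exact: (continuousD (cf x Ux) (cg x Ux)).
split=> [x Ux|A]; first by exact: (continuousD (cf x Ux) (cg x Ux)).
have [dfA CfA] := df A; have [dgA CgA] := dg A; split.
  by move=> x Ux; apply: derivableD; [exact: dfA|exact: dgA].
apply: (eq_Ck oU _ (IH _ _ CfA CgA)) => x Ux.
by rewrite /pd -deriveD //; [exact: dfA|exact: dgA].
Qed.

Lemma CkM k f g : Ck k U f -> Ck k U g -> Ck k U (fun x => f x * g x).
Proof.
elim: k f g => [|k IH] f g.
  move=> [cf df] [cg dg].
  by split=> // x Ux; exact: (continuousM (cf x Ux) (cg x Ux)).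
move=> Cf Cg; have [cf df] := Cf; have [cg dg] := Cg.
split=> [x Ux|A]; first by exact: (continuousM (cf x Ux) (cg x Ux)).
have [dfA CfA] := df A; have [dgA CgA] := dg A; split.
  by move=> x Ux; apply: derivableM; [exact: dfA|exact: dgA].
have C := CkD (IH _ _ (CkW Cf) CgA) (IH _ _ (CkW Cg) CfA).
apply: (eq_Ck oU _ C) => x Ux.
by rewrite /pd -[LHS]deriveM //; [exact: dfA|exact: dgA].
Qed.

Lemma CkV k f : (forall x, U x -> f x != 0) -> Ck k U f ->
  Ck k U (fun x => (f x)^-1).
Proof.
move=> f0; elim: k => [|k IH].
  by move=> [cf df]; split=> // x Ux; exact: (continuousV (f0 x Ux) (cf x Ux)).
move=> Cf; have [cf df] := Cf.
split=> [x Ux|A]; first by exact: (continuousV (f0 x Ux) (cf x Ux)).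
have [dfA CfA] := df A; split.
  by move=> x Ux; apply: derivableV; [exact: f0|exact: dfA].
have CV := IH (CkW Cf).
have C := CkM (Ck_cst k (-1)) (CkM (CkM CV CV) CfA).
apply: (eq_Ck oU _ C) => x Ux.
rewrite /pd deriveV ?f0 //; last exact: dfA.
by rewrite -exprVn expr2 mulN1r -mulNr.
Qed.

Lemma smooth_cst c : smooth U (fun=> c).
Proof. by move=> k; exact: Ck_cst. Qed.

Lemma smoothD f g : smooth U f -> smooth U g -> smooth U (fun x => f x + g x).
Proof. by move=> sf sg k; apply: CkD. Qed.

Lemma smoothM f g : smooth U f -> smooth U g -> smooth U (fun x => f x * g x).
Proof. by move=> sf sg k; apply: CkM. Qed.

Lemma smoothN f : smooth U f -> smooth U (fun x => - f x).
Proof.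
move=> sf; have := smoothM (smooth_cst (-1)) sf.
by apply: eq_smooth => // y _; rewrite mulN1r.
Qed.

Lemma smoothV f : (forall x, U x -> f x != 0) -> smooth U f ->
  smooth U (fun x => (f x)^-1).
Proof. by move=> f0 sf k; apply: CkV. Qed.

Lemma smooth_sum (I : Type) (r : seq I) (F : I -> 'rV[R]_m -> R) :
  (forall i, smooth U (F i)) -> smooth U (fun x => \sum_(i <- r) F i x).
Proof.
move=> sF; elim: r => [|i r IH].
  by apply: eq_smooth (smooth_cst 0) => // y _; rewrite big_nil.
by apply: eq_smooth (smoothD (sF i) IH) => // y _; rewrite big_cons.
Qed.

Lemma pd_cst c A x : pd A (fun=> c) x = 0.
Proof. exact: derive_cst. Qed.

Lemma pdD f g A x : U x -> smooth U f -> smooth U g ->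
  pd A (fun y => f y + g y) x = pd A f x + pd A g x.
Proof.
move=> Ux sf sg; rewrite /pd -deriveD //;
  [exact: smooth_derivable sf Ux|exact: smooth_derivable sg Ux].
Qed.

Lemma pdM f g A x : U x -> smooth U f -> smooth U g ->
  pd A (fun y => f y * g y) x = pd A f x * g x + f x * pd A g x.
Proof.
move=> Ux sf sg; rewrite addrC [pd A f x * _]mulrC /pd.
rewrite -[RHS]deriveM //;
  [exact: smooth_derivable sf Ux|exact: smooth_derivable sg Ux].
Qed.

Lemma pdMl c f A x : U x -> smooth U f ->
  pd A (fun y => c * f y) x = c * pd A f x.
Proof.
by move=> Ux sf; rewrite (pdM _ Ux (smooth_cst c) sf) pd_cst mul0r add0r.
Qed.

Lemma pdN f A x : U x -> smooth U f -> pd A (fun y => - f y) x = - pd A f x.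
Proof.
by move=> Ux sf; rewrite /pd -deriveN //; exact: smooth_derivable sf Ux.
Qed.

Lemma pdB f g A x : U x -> smooth U f -> smooth U g ->
  pd A (fun y => f y - g y) x = pd A f x - pd A g x.
Proof.
by move=> Ux sf sg; rewrite (pdD _ Ux sf (smoothN sg)) (pdN _ Ux sg).
Qed.

Lemma pdV f A x : U x -> f x != 0 -> smooth U f ->
  pd A (fun y => (f y)^-1) x = - pd A f x / f x ^+ 2.
Proof.
move=> Ux f0 sf; rewrite /pd deriveV //; last exact: smooth_derivable sf Ux.
by rewrite mulNr mulrC -mulNr.
Qed.

Lemma pd_sum (I : Type) (r : seq I) (F : I -> 'rV[R]_m -> R) A x : U x ->
  (forall i, smooth U (F i)) ->
  pd A (fun y => \sum_(i <- r) F i y) x = \sum_(i <- r) pd A (F i) x.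
Proof.
move=> Ux sF; elim: r => [|i r IH].
  rewrite big_nil -[RHS](pd_cst 0 A x).
  by apply: (eq_on_open_pd _ oU Ux) => y _; rewrite big_nil.
rewrite big_cons -IH -(pdD A Ux (sF i) (smooth_sum r sF)).
by apply: (eq_on_open_pd _ oU Ux) => y _; rewrite big_cons.
Qed.

End Pointwise.
End Calculus.

(** * Symmetry of second derivatives *)

Section Schwarz.
Context {R : realType} {m : nat}.
Implicit Types (U V : set 'rV[R]_m) (f g : 'rV[R]_m -> R) (x v w : 'rV[R]_m).

Lemma is_derive_line f x v (s : R) : derivable f (x + s *: v) v ->
  is_derive s 1 (fun t : R => f (x + t *: v)) ('D_v f (x + s *: v)).
Proof.
have E : (fun h : R => h^-1 *: (f (x + (h *: (1 : R) + s) *: v) - f (x + s *: v)))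
  = (fun h : R => h^-1 *: (f (h *: v + (x + s *: v)) - f (x + s *: v))).
  apply/funext => h; congr (_ *: (f _ - _)).
  by rewrite scalerDl [h *: 1]mulr1 addrCA.
move=> df; apply: DeriveDef; first by rewrite /derivable /= E.
by rewrite /derive /= E.
Qed.

Lemma MVT_line f x v (h : R) : 0 < h ->
  (forall s, 0 <= s <= h -> derivable f (x + s *: v) v) ->
  exists2 c, 0 < c < h & f (x + h *: v) - f x = 'D_v f (x + c *: v) * h.
Proof.
move=> h0 df.
have dl s : 0 <= s <= h -> is_derive s 1 (fun t : R => f (x + t *: v))
    ('D_v f (x + s *: v)).
  by move=> /df; exact: is_derive_line.
have [|s|c] := @MVT R (fun t : R => f (x + t *: v))
    (fun s => 'D_v f (x + s *: v)) 0 h h0.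
- by move=> s; rewrite in_itv /= => /andP[/ltW s0 /ltW sh]; apply: dl; rewrite s0.
- apply: derivable_within_continuous => t; rewrite in_itv /= => th.
  by have [] := dl t th.
- rewrite in_itv /= scale0r addr0 subr0 => ch Ec.
  by exists c.
Qed.

(** The mean value theorem is applied inside a small parallelogram spanned by
    v and w; continuity only gives a ball, hence this bridge. *)
Lemma near_square (P : 'rV[R]_m -> Prop) x v w : (\near x, P x) ->
  exists2 h : R, 0 < h & forall s t, 0 <= s <= h -> 0 <= t <= h ->
    P (x + s *: v + t *: w).
Proof.
move=> /nbhs_ballP[eps /= eps0 ballP].
have K0 : 0 < `|v| + `|w| + 1 by rewrite ltr_wpDl // addr_ge0.
exists (eps / (`|v| + `|w| + 1) / 2); first by rewrite !divr_gt0.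
move=> s t /andP[s0 sh] /andP[t0 th]; apply: ballP.
rewrite -ball_normE /= -addrA opprD addNKr normrN.
apply: le_lt_trans (ler_normD _ _) _; rewrite !normrZ !ger0_norm //.
set h := eps / _ / 2 in sh th *.
have h0 : 0 < h by rewrite !divr_gt0.
have hE : h * (`|v| + `|w| + 1) < eps.
  by rewrite /h mulrAC divfK ?gt_eqF // gtr_pMr // invf_lt1 ?ltr1n.
apply: le_lt_trans hE; rewrite !mulrDr mulr1.
by apply: ler_wpDr; [exact: ltW|apply: lerD; exact: ler_wpM2r].
Qed.

(** Mean value theorem in direction A for the increment of f in direction B,
    then in direction B for its A-derivative. *)
Lemma second_difference U f x (A B : 'I_m) (h : R) : smooth U f -> 0 < h ->
  (forall s t, 0 <= s <= h -> 0 <= t <= h ->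
     U (x + s *: delta_mx 0 A + t *: delta_mx 0 B)) ->
  exists s t, [/\ 0 <= s <= h, 0 <= t <= h &
    f (x + h *: delta_mx 0 A + h *: delta_mx 0 B) - f (x + h *: delta_mx 0 A)
    - (f (x + h *: delta_mx 0 B) - f x) =
    pd B (pd A f) (x + s *: delta_mx 0 A + t *: delta_mx 0 B) * h ^+ 2].
Proof.
move=> sf h0 sq; set v : 'rV[R]_m := delta_mx 0 A; set w : 'rV[R]_m := delta_mx 0 B.
have hh : 0 <= h <= h by rewrite lexx ltW.
have oh : 0 <= (0 : R) <= h by rewrite lexx ltW.
have shiftE y : ('D_v (fun y => f (y + h *: w)) y = pd A f (y + h *: w)) *
    (derivable (fun y => f (y + h *: w)) y v = derivable f (y + h *: w) v).
  have E : (fun k : R => k^-1 *: (f (k *: v + y + h *: w) - f (y + h *: w)))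
    = (fun k : R => k^-1 *: (f (k *: v + (y + h *: w)) - f (y + h *: w))).
    by apply/funext => k; rewrite addrA.
  by split; rewrite /derivable /pd /derive /= E.
have d1 s : 0 <= s <= h -> derivable (fun y => f (y + h *: w)) (x + s *: v) v.
  by move=> sh; rewrite shiftE; apply: smooth_derivable sf _; exact: sq.
have d2 s : 0 <= s <= h -> derivable f (x + s *: v) v.
  move=> sh; apply: smooth_derivable sf _.
  by have := sq s 0 sh oh; rewrite scale0r addr0.
have [|s /andP[/ltW s0 /ltW sh] Es] :=
    @MVT_line (fun y => f (y + h *: w) - f y) x v h h0.
  by move=> s sh; apply: derivableB; [exact: d1|exact: d2].
have shh : 0 <= s <= h by rewrite s0.
have [|t /andP[/ltW t0 /ltW th] Et] := @MVT_line (pd A f) (x + s *: v) w h h0.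
  move=> t th; apply: (smooth_derivable (smooth_pd A sf)); exact: sq.
exists s, t; split; rewrite ?s0 ?t0 //.
rewrite Es deriveB; [|exact: d1|exact: d2].
by rewrite shiftE -/(pd A f (x + s *: v)) Et -mulrA -expr2.
Qed.

(** The second difference quotient of f is symmetric in A and B, and each of
    the two iterated derivatives takes it as a value at points arbitrarily close
    to x; continuity at x then forces equality. *)
Lemma pdC U f x (A B : 'I_m) : open U -> smooth U f -> U x ->
  pd A (pd B f) x = pd B (pd A f) x.
Proof.
move=> oU sf Ux; apply/eqP/negP => /negP ne.
set a := pd A (pd B f) x in ne *; set b := pd B (pd A f) x in ne *.
have eps0 : 0 < `|a - b| / 2 by rewrite divr_gt0 // normr_gt0 subr_eq0.
have close g : smooth U g -> \forall y \near x, `|g x - g y| < `|a - b| / 2.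
  move=> sg; have /cvgrPdist_lt cg := smooth_continuous sg Ux.
  exact: cg eps0.
have ca := close _ (smooth_pd A (smooth_pd B sf)).
have cb := close _ (smooth_pd B (smooth_pd A sf)).
have nU : \near x, U x by exact: open_nbhs_nbhs.
pose good y := [/\ U y, `|a - pd A (pd B f) y| < `|a - b| / 2 &
  `|b - pd B (pd A f) y| < `|a - b| / 2].
have ngood : \forall y \near x, good y.
  apply: (@filterS _ (nbhs x) _ _ _ _ (filterI nU (filterI ca cb))).
  by move=> y [H1 [H2 H3]]; exact: And3 H1 H2 H3.
have [h1 h10 sq1] := near_square (delta_mx 0 A) (delta_mx 0 B) ngood.
have [h2 h20 sq2] := near_square (delta_mx 0 B) (delta_mx 0 A) ngood.
pose h := Num.min h1 h2.
have h0 : 0 < h by rewrite lt_min h10.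
have hle s : 0 <= s <= h -> (0 <= s <= h1) * (0 <= s <= h2).
  by rewrite le_min => /and3P[-> -> ->].
have [|s [t [sh th E1]]] := @second_difference U f x A B h sf h0.
  by move=> s t /hle[sh _] /hle[th _]; have [H _ _] := sq1 _ _ sh th; exact: H.
have [|s' [t' [sh' th' E2]]] := @second_difference U f x B A h sf h0.
  by move=> u u' /hle[_ uh] /hle[_ uh']; have [H _ _] := sq2 _ _ uh uh'; exact: H.
have [_ _ g1] := sq1 s t (hle _ sh).1 (hle _ th).1.
have [_ g2 _] := sq2 s' t' (hle _ sh').2 (hle _ th').2.
have hne : h ^+ 2 != 0 by rewrite expf_neq0 // gt_eqF.
set c := pd B (pd A f) _ in g1 E1; set c' := pd A (pd B f) _ in g2 E2.
have Ecc : c * h ^+ 2 = c' * h ^+ 2.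
  (* the second difference is symmetric in the two directions *)
  have swap (p q r u : R) : p - q - (r - u) = p - r - (q - u) by ring.
  have Exy := addrAC x (h *: delta_mx 0 A) (h *: delta_mx 0 B).
  rewrite Exy in E1.
  exact: etrans (esym E1) (etrans (swap _ _ _ _) E2).
have {Ecc} Ecc := mulIf hne Ecc.
rewrite -Ecc in g2.
have tri (p q r : R) : `|p - r| < `|p - q| / 2 -> `|q - r| < `|p - q| / 2 -> False.
  move=> pr qr; have : `|p - q| < `|p - q|; last by rewrite ltxx.
  rewrite [X in _ < X]splitr; apply: le_lt_trans (ler_distD r _ _) _.
  by rewrite [`|r - q|]distrC; apply: ltrD.
exact: tri g2 g1.
Qed.

End Schwarz.

(** * Substitution of cotangent coordinates *)

Section Substitution.
Context {R : realType} {m k : nat}.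
Implicit Types (f : 'rV[R]_m -> R) (L : 'rV[R]_k -> 'rV[R]_m).

(** L is affine in the A-th variable with direction v. Such an L commutes
    with difference quotients on the nose, so no chain rule (hence no total
    differentiability) is required; the projection and the inclusions of
    the cotangent charts are all of this kind. *)
Definition moves_along L (A : 'I_k) (v : 'rV[R]_m) :=
  forall (h : R) y, L (h *: delta_mx 0 A + y) = h *: v + L y.

Lemma pd_subst L A a f y : moves_along L A (delta_mx 0 a) ->
  pd A (f \o L) y = pd a f (L y).
Proof.
move=> LA; rewrite /pd /derive /=.
by under [in LHS]eq_fun do rewrite LA.
Qed.

Lemma pd_subst0 L A f y : moves_along L A 0 -> pd A (f \o L) y = 0.
Proof.
move=> LA; rewrite -[RHS](derive_cst (f (L y)) y (delta_mx 0 A)) /pd /derive /=.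
by under [in LHS]eq_fun do rewrite LA scaler0 add0r.
Qed.

Lemma smooth_subst L U f : continuous L ->
  (forall A, (exists a, moves_along L A (delta_mx 0 a)) \/ moves_along L A 0) ->
  smooth U f -> smooth (L @^-1` U) (f \o L).
Proof.
move=> cL HL sf j; have {sf} := sf j.
have cc (g : _ -> R) y : {for L y, continuous g} -> {for y, continuous (g \o L)}.
  by move=> cg; exact: (continuous_comp (cL y) cg).
elim: j f => [|j IH] f [cf df].
  by split=> // y Uy; apply: cc; exact: cf.
split=> [y Uy|A]; first by apply: cc; exact: cf.
case: (HL A) => [[a La]|L0].
  have [dfa Ca] := df a; split.
    move=> y Uy; rewrite /derivable /=.
    by under eq_fun do rewrite La; exact: dfa.
  have -> : pd A (f \o L) = pd a f \o L by apply/funext => y; exact: pd_subst.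
  exact: IH.
split.
  move=> y Uy; rewrite /derivable /=.
  under eq_fun do rewrite L0 scaler0 add0r.
  exact: (derivable_cst (f (L y)) y (delta_mx 0 A)).
have -> : pd A (f \o L) = fun=> 0 by apply/funext => y; exact: pd_subst0.
exact: Ck_cst.
Qed.

End Substitution.

Section Coordinates.
Context {R : realType}.

Lemma pd_coord m (A k : 'I_m) (y : 'rV[R]_m) :
  pd A (fun z => z 0 k) y = (A == k)%:R.
Proof.
rewrite /pd /derive; apply: cvg_lim => //; apply: cvg_near_cst.
apply: filterS (nbhs_dnbhs_neq 0) => h /= h0.
rewrite !mxE eqxx /= addrK eq_sym.
by rewrite [LHS](mulKf h0).
Qed.

Lemma smooth_coord m (k : 'I_m) U : smooth U (fun z : 'rV[R]_m => z 0 k).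
Proof.
case=> [|j]; first by split=> // y _; exact: coord_continuous.
split=> [y _|A]; first exact: coord_continuous.
split=> [y _|].
  apply: diff_derivable; exact: differentiable_coord.
rewrite [pd A _](_ : _ = fun=> (A == k)%:R); first exact: Ck_cst.
by apply/funext => y; exact: pd_coord.
Qed.

Context {n : nat}.
Implicit Types (x p : 'rV[R]_n).

Lemma continuous_row_mxl p :
  continuous (fun x => row_mx x p : 'rV[R]_(n + n)).
Proof.
move=> u A /nbhs_ballP[eps /= eps0 epsA].
apply/nbhs_ballP; exists eps => //= v [_ uv]; apply: epsA; split => // i j.
case: (split_ordP j) => k ->; first by rewrite !row_mxEl; exact: uv.
by rewrite !row_mxEr; exact: ballxx.
Qed.

Lemma continuous_row_mxr x :
  continuous (fun p => row_mx x p : 'rV[R]_(n + n)).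
Proof.
move=> u A /nbhs_ballP[eps /= eps0 epsA].
apply/nbhs_ballP; exists eps => //= v [_ uv]; apply: epsA; split => // i j.
case: (split_ordP j) => k ->; last by rewrite !row_mxEr; exact: uv.
by rewrite !row_mxEl; exact: ballxx.
Qed.

Lemma delta_lshift (A : 'I_n) :
  delta_mx 0 (lshift n A) = row_mx (delta_mx 0 A) 0 :> 'rV[R]_(n + n).
Proof.
apply/rowP => j; case: (split_ordP j) => k ->.
  by rewrite row_mxEl !mxE eq_lshift.
by rewrite row_mxEr !mxE eq_rlshift.
Qed.

Lemma delta_rshift (A : 'I_n) :
  delta_mx 0 (rshift n A) = row_mx 0 (delta_mx 0 A) :> 'rV[R]_(n + n).
Proof.
apply/rowP => j; case: (split_ordP j) => k ->.
  by rewrite row_mxEl !mxE eq_lrshift.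
by rewrite row_mxEr !mxE eq_rshift.
Qed.

Lemma moves_along_base p (A : 'I_n) :
  moves_along (fun x => row_mx x p) A (delta_mx 0 (lshift n A)).
Proof.
by move=> h y; rewrite delta_lshift scale_row_mx add_row_mx scaler0 add0r.
Qed.

Lemma moves_along_fibre x (A : 'I_n) :
  moves_along (fun p => row_mx x p) A (delta_mx 0 (rshift n A)).
Proof.
by move=> h y; rewrite delta_rshift scale_row_mx add_row_mx scaler0 add0r.
Qed.

Lemma moves_along_lsubmx (A : 'I_n) :
  moves_along (lsubmx : 'rV[R]_(n + n) -> 'rV_n) (lshift n A) (delta_mx 0 A).
Proof.
by move=> h y; rewrite linearD linearZ /= delta_lshift row_mxKl.
Qed.

Lemma lsubmx_ignores_fibre (A : 'I_n) :
  moves_along (lsubmx : 'rV[R]_(n + n) -> 'rV_n) (rshift n A) 0.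
Proof.
by move=> h y; rewrite linearD linearZ /= delta_rshift row_mxKl.
Qed.

Lemma smooth_lsubmx U (f : 'rV[R]_n -> R) : smooth U f ->
  smooth [set z : 'rV[R]_(n + n) | U (lsubmx z)] (fun z => f (lsubmx z)).
Proof.
apply: (smooth_subst (L := lsubmx)); first exact: continuous_lsubmx.
move=> A; case: (split_ordP A) => j ->.
  by left; exists j; exact: moves_along_lsubmx.
by right; exact: lsubmx_ignores_fibre.
Qed.

Lemma pd_lsubmx (f : 'rV[R]_n -> R) A (z : 'rV[R]_(n + n)) :
  pd (lshift n A) (fun z : 'rV[R]_(n + n) => f (lsubmx z)) z = pd A f (lsubmx z).
Proof. exact: (pd_subst f z (@moves_along_lsubmx A)). Qed.

Lemma pd_lsubmx0 (f : 'rV[R]_n -> R) A (z : 'rV[R]_(n + n)) :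
  pd (rshift n A) (fun z : 'rV[R]_(n + n) => f (lsubmx z)) z = 0.
Proof. exact: (pd_subst0 f z (@lsubmx_ignores_fibre A)). Qed.

Lemma smooth_base U (f : 'rV[R]_(n + n) -> R) p :
  smooth [set z | U (lsubmx z)] f -> smooth U (fun x => f (row_mx x p)).
Proof.
move=> sf; have H : smooth ((fun x => row_mx x p) @^-1` [set z | U (lsubmx z)])
    (f \o (fun x => row_mx x p)).
  apply: smooth_subst sf; first exact: continuous_row_mxl.
  by move=> A; left; exists (lshift n A); exact: moves_along_base.
apply: sub_smooth H => x Ux /=; by rewrite /preimage /= row_mxKl.
Qed.

Lemma pd_fibre (f : 'rV[R]_(n + n) -> R) A x p :
  pd A (fun p => f (row_mx x p)) p = pd (rshift n A) f (row_mx x p).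
Proof. exact: (pd_subst f p (@moves_along_fibre x A)). Qed.

Lemma smooth_fibre U (f : 'rV[R]_(n + n) -> R) x : U x ->
  smooth [set z | U (lsubmx z)] f -> smooth setT (fun p => f (row_mx x p)).
Proof.
move=> Ux sf.
have H : smooth ((fun p => row_mx x p) @^-1` [set z | U (lsubmx z)])
    (f \o (fun p => row_mx x p)).
  apply: smooth_subst sf; first exact: continuous_row_mxr.
  by move=> A; left; exists (rshift n A); exact: moves_along_fibre.
apply: sub_smooth H => p _ /=; by rewrite /preimage /= row_mxKl.
Qed.

End Coordinates.

(** * Functions with vanishing derivatives *)

Section Vanishing.
Context {R : realType} {m : nat}.
Implicit Types (f : 'rV[R]_m -> R).

Lemma open_neq0 (U : set 'rV[R]_m) f : open U -> smooth U f ->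
  open (U `&` [set x | f x != 0]).
Proof.
move=> oU sf; rewrite openE => x [Ux fx]; apply: filterI.
  exact: open_nbhs_nbhs.
have o : open [set r : R | r != 0] by exact: open_neq.
have c : f @ x --> f x by exact: smooth_continuous sf Ux.
by apply: (c [set r | r != 0]); exact: open_nbhs_nbhs.
Qed.

(** Only partial derivatives are at hand, so x is reached from 0 along the
    coordinate directions, one at a time. *)
Lemma constant_of_pd f : smooth setT f -> (forall A x, pd A f x = 0) ->
  forall x, f x = f 0.
Proof.
move=> sf f0.
have step0 A x (t : R) : 0 < t -> f (x + t *: delta_mx 0 A) = f x.
  move=> t0.
  have [|c _] := @MVT_line R m f x (delta_mx 0 A) t t0.
    by move=> s _; apply: (smooth_derivable sf).
  by rewrite -/(pd A f _) f0 mul0r => /eqP; rewrite subr_eq0 => /eqP.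
have step A x (t : R) : f (x + t *: delta_mx 0 A) = f x.
  have [t0|t0|<-] := ltgtP 0 t; [exact: step0| |by rewrite scale0r addr0].
  have := step0 A (x + t *: delta_mx 0 A) (- t).
  by rewrite oppr_gt0 scaleNr addrK => ->.
move=> x; rewrite [x]row_sum_delta; elim: (index_enum _) => [|A r IH].
  by rewrite big_nil.
by rewrite big_cons addrC step.
Qed.

(** The first derivatives are constant, and so is f minus its linear part. *)
Lemma affine_of_pd2 f : smooth setT f -> (forall A B x, pd A (pd B f) x = 0) ->
  forall x, f x = \sum_K pd K f 0 * x 0 K + f 0.
Proof.
move=> sf f2 x.
have c1 K y : pd K f y = pd K f 0.
  by apply: constant_of_pd => //; exact: smooth_pd.
have sK K : smooth setT (fun y : 'rV[R]_m => pd K f 0 * y 0 K).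
  by apply: (smoothM openT); [exact: smooth_cst|exact: smooth_coord].
have sS : smooth setT (fun y : 'rV[R]_m => \sum_K pd K f 0 * y 0 K).
  by apply: (smooth_sum openT).
have sd : smooth setT (fun y => f y - \sum_K pd K f 0 * y 0 K).
  by apply: (smoothD openT) => //; exact: (smoothN openT).
have dd A y : pd A (fun y => f y - \sum_K pd K f 0 * y 0 K) y = 0.
  have Ty : [set: 'rV[R]_m] y by [].
  rewrite (pdB openT A Ty sf sS) (pd_sum openT _ A Ty sK) c1.
  rewrite (eq_bigr (fun K => (A == K)%:R * pd K f 0)) => [|K _].
    by rewrite sum_delta_sym subrr.
  by rewrite (pdMl _ A Ty (smooth_coord K setT)) pd_coord mulrC.
have := constant_of_pd sd dd x.
move=> /eqP; rewrite [X in _ == _ - X]big1 => [|K _]; last by rewrite mxE mulr0.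
by rewrite subr0 subr_eq addrC => /eqP.
Qed.

End Vanishing.

(** * Ricci tensor, Hessian and Levi-Civita connection in coordinates *)

Section Ricci.
Context {R : realType} {m : nat} (U : set 'rV[R]_m) (oU : open U).
Implicit Types (G T : christoffel R m) (x : 'rV[R]_m).

Lemma eq_ricci G G' x a b : U x ->
  (forall y, U y -> forall A C B, G y A C B = G' y A C B) ->
  ricci G x a b = ricci G' x a b.
Proof.
move=> Ux GG'; apply: eq_bigr => A _; rewrite /curvature; congr (_ - _ + _).
- by apply: (eq_on_open_pd _ oU Ux) => y Uy; exact: GG'.
- by apply: (eq_on_open_pd _ oU Ux) => y Uy; exact: GG'.
- by apply: eq_bigr => K _; rewrite !GG'.
Qed.

Lemma ricciD G T x b e : U x ->
  (forall A C B, smooth U (fun y => G y A C B)) ->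
  (forall A C B, smooth U (fun y => T y A C B)) ->
  ricci (fun y A C B => G y A C B + T y A C B) x b e =
  ricci G x b e
  + (\sum_a pd a (fun y => T y b a e) x - \sum_a pd b (fun y => T y a a e) x)
  + (\sum_a \sum_k G x a a k * T x b k e + \sum_a \sum_k T x a a k * G x b k e
     - \sum_a \sum_k G x b a k * T x a k e
     - \sum_a \sum_k T x b a k * G x a k e)
  + (\sum_a \sum_k T x a a k * T x b k e
     - \sum_a \sum_k T x b a k * T x a k e).
Proof.
move=> Ux sG sT; rewrite /ricci -!sumrN -!big_split /=; apply: eq_bigr => a _.
rewrite /curvature !(pdD _ Ux) // -!sumrN.
rewrite (_ : \sum_K _ = \sum_k (G x a a k * G x b k e - G x b a k * G x a k e)
  + (\sum_k G x a a k * T x b k e + \sum_k T x a a k * G x b k e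
     + \sum_k - (G x b a k * T x a k e) + \sum_k - (T x b a k * G x a k e)
  + (\sum_k T x a a k * T x b k e + \sum_k - (T x b a k * T x a k e)))).
  ring.
by rewrite -!big_split /=; apply: eq_bigr => k _; ring.
Qed.

(** A connection without trace preserves the coordinate volume; both terms of
    the Ricci tensor with a traced connection then drop out. *)
Lemma ricci_unimodular G x b e : U x ->
  (forall A C B, smooth U (fun y => G y A C B)) ->
  (forall y k, U y -> \sum_a G y a a k = 0) ->
  ricci G x b e =
  \sum_a pd a (fun y => G y b a e) x - \sum_a \sum_k G x b a k * G x a k e.
Proof.
move=> Ux sG trG; rewrite /ricci /curvature !big_split /= sumrN.
have -> : \sum_a pd b (fun y => G y a a e) x = 0.
  rewrite -(pd_sum oU _ _ Ux (fun a => sG a a e)).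
  by rewrite (eq_on_open_pd _ oU Ux (fun y Uy => trG y e Uy)) pd_cst.
rewrite subr0; congr (_ + _); under eq_bigr do rewrite sumrB.
rewrite sumrB [X in X - _]exchange_big /= big1 ?sub0r // => k _.
by rewrite -mulr_suml trG // mul0r.
Qed.

Lemma smooth_ricci G a b : (forall A C B, smooth U (fun y => G y A C B)) ->
  smooth U (fun y => ricci G y a b).
Proof.
move=> sG; apply: smooth_sum => // A; apply: smoothD => //.
  apply: smoothD => //; first exact/smooth_pd.
  by apply: smoothN => //; exact/smooth_pd.
apply: smooth_sum => // K; apply: smoothD => //; first exact: smoothM.
by apply: smoothN => //; exact: smoothM.
Qed.

Lemma hessianE G f x a b :
  hessian G f x a b = pd a (pd b f) x - \sum_c G x a c b * pd c f x.
Proof.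
rewrite /hessian /nabla_covec; congr (pd a _ x - _).
  by apply/funext => y; rewrite mxE.
by apply: eq_bigr => c _; rewrite mxE.
Qed.

Lemma smooth_hessian G f a b : (forall A C B, smooth U (fun y => G y A C B)) ->
  smooth U f -> smooth U (fun y => hessian G f y a b).
Proof.
move=> sG sf; apply: eq_smooth (oU) (fun y _ => esym (hessianE G f y a b)) _.
apply: smoothD => //; first exact/smooth_pd/smooth_pd.
apply: smoothN => //; apply: smooth_sum => // c; apply: smoothM => //.
exact: smooth_pd.
Qed.

End Ricci.

Section LeviCivita.
Context {R : realType} {m : nat} (U : set 'rV[R]_m) (oU : open U).
Context (g : 'rV[R]_m -> 'M[R]_m).
Hypothesis smooth_g : forall a b, smooth U (fun x => g x a b).
Hypothesis smooth_inv : forall a b, smooth U (fun x => invmx (g x) a b).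
Hypothesis sym_g : forall x a b, U x -> g x a b = g x b a.
Hypothesis unit_g : forall x, U x -> g x \in unitmx.

Local Notation Gam := (levi_civita g).
Local Notation h x := (invmx (g x)).

Lemma inv_metricl x a b : U x -> \sum_k h x a k * g x k b = (a == b)%:R.
Proof.
move=> Ux; have /matrixP/(_ a b) := mulVmx (unit_g Ux).
by rewrite !mxE.
Qed.

Lemma inv_metric_sym x a b : U x -> h x a b = h x b a.
Proof.
move=> Ux; have gT : (g x)^T = g x by apply/matrixP => i j; rewrite mxE sym_g.
by rewrite -{1}gT -trmx_inv mxE.
Qed.

Lemma inv_metricr x a b : U x -> \sum_k g x a k * h x k b = (a == b)%:R.
Proof.
move=> Ux; have /matrixP/(_ a b) := mulmxV (unit_g Ux).
by rewrite !mxE.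
Qed.

Lemma smooth_levi_civita a c b : smooth U (fun x => Gam x a c b).
Proof.
apply: smoothM => //; first exact: smooth_cst.
apply: smooth_sum => // k; apply: smoothM => //.
apply: smoothD => //; last by apply: smoothN => //; exact/smooth_pd.
by apply: smoothD => //; exact/smooth_pd.
Qed.

Lemma levi_civita_sym x a c b : U x -> Gam x a c b = Gam x b c a.
Proof.
move=> Ux; rewrite /levi_civita; congr (_ * _); apply: eq_bigr => k _.
rewrite [pd k (fun y => g y a b) x](eq_on_open_pd (g := fun y => g y b a) _ oU Ux); last first.
  by move=> y Uy; exact: sym_g.
congr (_ * _); ring.
Qed.

(** Lowering the index gives the Christoffel symbols of the first kind, free of
    the inverse metric. *)
Lemma levi_civita_lower x a b e : U x ->
  \sum_k Gam x a k b * g x k e =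
  2^-1 * (pd a (fun y => g y b e) x + pd b (fun y => g y a e) x
          - pd e (fun y => g y a b) x).
Proof.
move=> Ux; pose X l := pd a (fun y => g y b l) x + pd b (fun y => g y a l) x
          - pd l (fun y => g y a b) x.
transitivity (\sum_k \sum_l 2^-1 * X l * (h x l k * g x k e)).
  apply: eq_bigr => k _; rewrite /levi_civita mulr_sumr mulr_suml.
  by apply: eq_bigr => l _; rewrite (inv_metric_sym k l Ux) -/(X l); ring.
rewrite exchange_big /=.
under eq_bigr do rewrite -mulr_sumr (inv_metricl _ _ Ux) mulrC.
exact: sum_delta.
Qed.

Lemma metric_compat x a b e : U x ->
  pd a (fun y => g y b e) x =
  \sum_k Gam x a k b * g x k e + \sum_k Gam x a k e * g x k b.
Proof.
move=> Ux; rewrite !levi_civita_lower //.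
rewrite [pd a (fun y => g y e b) x](eq_on_open_pd (g := fun y => g y b e) _ oU Ux); last first.
  by move=> y Uy; exact: sym_g.
by field.
Qed.

End LeviCivita.

(** * Conformal change of the metric *)

Section ConformalAlgebra.
Context {R : realType} {m : nat} (g : 'I_m -> 'I_m -> R) (u v : 'I_m -> R).
Hypothesis sym_g : forall a b, g a b = g b a.
Hypothesis lower_v : forall a, \sum_k g a k * v k = u a.
Implicit Types (F : 'I_m -> R) (G : 'I_m -> 'I_m -> 'I_m -> R).

(** The difference of the Levi-Civita connections of s^-2 g and g, for u the
    logarithmic gradient of s and v the vector with u = g v. *)
Definition conf_diff a c b : R :=
  g a b * v c - u a * (c == b)%:R - u b * (c == a)%:R.

Local Notation T := conf_diff.

Let N := \sum_k u k * v k.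

Lemma conf_diff_contr a c F : \sum_k T a c k * F k =
  (\sum_k g a k * F k) * v c - u a * F c - (\sum_k u k * F k) * (c == a)%:R.
Proof.
rewrite -[F c](sum_delta_sym F) mulr_sumr !mulr_suml -!sumrB.
by apply: eq_bigr => k _; rewrite /T; ring.
Qed.

Lemma conf_diff_trace k : \sum_a T a a k = - (m%:R * u k).
Proof.
rewrite (eq_bigr (fun a => g k a * v a - (a == k)%:R * u a - u k)).
  by rewrite !sumrB lower_v sum_delta sumr_const card_ord -mulr_natl; ring.
by move=> a _; rewrite /T (sym_g a k) eqxx mulr1; ring.
Qed.

Lemma lower_conf_diff a b e : \sum_k g b k * T a k e =
  g a e * u b - u a * g b e - u e * g a b.
Proof.
rewrite (eq_bigr (fun k => g a e * (g b k * v k) - u a * ((k == e)%:R * g b k)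
   - u e * ((k == a)%:R * g b k))) => [|k _]; last by rewrite /T; ring.
by rewrite !sumrB -!mulr_sumr !sum_delta lower_v (sym_g b a).
Qed.

Lemma grad_conf_diff a e : \sum_k u k * T a k e = g a e * N - 2 * u a * u e.
Proof.
rewrite (eq_bigr (fun k => g a e * (u k * v k) - u a * ((k == e)%:R * u k)
   - u e * ((k == a)%:R * u k))) => [|k _]; last by rewrite /T; ring.
by rewrite !sumrB -!mulr_sumr !sum_delta -/N; ring.
Qed.

Lemma conf_diff_quadratic b e :
  \sum_a \sum_k T a a k * T b k e - \sum_a \sum_k T b a k * T a k e =
  (m%:R - 2) * (u b * u e) - (m%:R - 2) * N * g b e.
Proof.
rewrite exchange_big /=.
under eq_bigr do rewrite -mulr_suml conf_diff_trace.
rewrite (eq_bigr (fun k => - m%:R * (u k * T b k e))) => [|k _]; last by ring.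
rewrite -mulr_sumr grad_conf_diff.
rewrite [X in _ - X](eq_bigr (fun a => (- u e) * (g b a * v a)
  + (- u b) * T a a e + 2 * u e * ((a == b)%:R * u a)
  + (- N) * ((a == b)%:R * g a e) + (- g b e) * (u a * v a)
  + u b * (g e a * v a))); last first.
  move=> a _; rewrite conf_diff_contr lower_conf_diff grad_conf_diff.
  rewrite (sym_g e a) (sym_g b a); set t := T a a e; set d := (_ == _)%:R.
  by set N' := N; ring.
rewrite !big_split /= -!mulr_sumr !sum_delta conf_diff_trace !lower_v -/N.
by set N' := N; ring.
Qed.

(** In the terms mixing the difference tensor with a torsion-free G, the
    connection survives only through the covariant derivative of u, through
    that of g, and in a multiple of g. *)
Lemma conf_diff_cross G b e : (forall a c k, G a c k = G k c a) ->
  \sum_a \sum_k G a a k * T b k e + \sum_a \sum_k T a a k * G b k e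
  - \sum_a \sum_k G b a k * T a k e - \sum_a \sum_k T b a k * G a k e =
  (2 - m%:R) * (\sum_k G b k e * u k) + g b e * (\sum_k (\sum_a G a a k) * v k)
  - \sum_a (\sum_k G a k b * g k e + \sum_k G a k e * g k b) * v a.
Proof.
move=> sG.
set tr := fun k => \sum_a G a a k; pose uG := \sum_k G b k e * u k.
have E1 : \sum_a \sum_k G a a k * T b k e =
    g b e * (\sum_k tr k * v k) - u b * tr e - u e * tr b.
  rewrite exchange_big /=; under eq_bigr do rewrite -mulr_suml -/(tr _).
  rewrite (eq_bigr (fun k => g b e * (tr k * v k) - u b * ((k == e)%:R * tr k)
    - u e * ((k == b)%:R * tr k))) => [|k _]; last by rewrite /T; ring.
  by rewrite !sumrB -!mulr_sumr !sum_delta.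
have E2 : \sum_a \sum_k T a a k * G b k e = - m%:R * uG.
  rewrite exchange_big /=; under eq_bigr do rewrite -mulr_suml conf_diff_trace.
  by rewrite /uG mulr_sumr; apply: eq_bigr => k _; ring.
have E3 : \sum_a \sum_k G b a k * T a k e =
    \sum_a (\sum_k G a k b * g k e) * v a - uG - u e * tr b.
  rewrite [X in X - _ - _](eq_bigr (fun a => \sum_k g k e * v a * G a k b)); last first.
    by move=> a _; rewrite mulr_suml; apply: eq_bigr => k _; ring.
  rewrite [X in _ = X - _ - _]exchange_big /= /uG /tr mulr_sumr -!sumrB; apply: eq_bigr => a _.
  rewrite (eq_bigr (fun k => g a e * v k * G k a b - u a * ((k == e)%:R * G b a k)
   - u e * ((k == a)%:R * G b a k))) => [|k _]; last by rewrite /T (sG k a b); ring.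
  by rewrite !sumrB -!mulr_sumr !sum_delta (sG a a b); ring.
have E4 : \sum_a \sum_k T b a k * G a k e =
    \sum_a (\sum_k G a k e * g k b) * v a - u b * tr e - uG.
  rewrite (eq_bigr (fun a => (\sum_k G a k e * g k b) * v a - u b * G a a e
     - (a == b)%:R * (\sum_k G a k e * u k))).
    by rewrite !sumrB -mulr_sumr sum_delta.
  move=> a _; rewrite conf_diff_contr [_ * (a == b)%:R]mulrC.
  congr (_ * _ - _ - _ * _); apply: eq_bigr => k _; rewrite mulrC //.
  by rewrite (sym_g b).
rewrite E1 E2 E3 E4 (eq_bigr _ (fun a _ => mulrDl _ _ _)) big_split /= -/uG.
by set tb := tr b; set te := tr e; set S1 := \sum_a _; set S2 := \sum_a _ * _; ring.
Qed.

End ConformalAlgebra.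

(* Only the rules of calculus above are used on partial derivatives below. *)
#[local] Opaque pd.

Section Conformal.
Context {R : realType} {m : nat} (U : set 'rV[R]_m) (oU : open U).
Context (g : 'rV[R]_m -> 'M[R]_m) (s : 'rV[R]_m -> R).
Hypothesis smooth_g : forall a b, smooth U (fun x => g x a b).
Hypothesis smooth_inv : forall a b, smooth U (fun x => invmx (g x) a b).
Hypothesis sym_g : forall x a b, U x -> g x a b = g x b a.
Hypothesis unit_g : forall x, U x -> g x \in unitmx.
Hypothesis smooth_s : smooth U s.
Hypothesis s_neq0 : forall x, U x -> s x != 0.

Local Notation Gam := (levi_civita g).
Local Notation h x := (invmx (g x)).

Definition dlog (a : 'I_m) x : R := pd a s x / s x.
Definition dlog_up (a : 'I_m) x : R := \sum_k h x a k * dlog k x.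

Definition conf_change : christoffel R m := fun x =>
  conf_diff (g x) (dlog^~ x) (dlog_up^~ x).

Let smooth_dlog a : smooth U (dlog a).
Proof. by apply: smoothM => //; [exact: smooth_pd|exact: smoothV]. Qed.

Let smooth_dlog_up a : smooth U (dlog_up a).
Proof. by apply: smooth_sum => // k; exact: smoothM. Qed.

Let smooth_conf_change a c b : smooth U (fun x => conf_change x a c b).
Proof.
have sc (r : bool) : smooth U (fun=> r%:R) by exact: smooth_cst.
apply: smoothD => //; last by apply: smoothN => //; exact: smoothM.
by apply: smoothD => //; [exact: smoothM|apply: smoothN => //; exact: smoothM].
Qed.

Lemma lower_dlog_up x a : U x -> \sum_k g x a k * dlog_up k x = dlog a x.
Proof.
move=> Ux; rewrite /dlog_up.
under eq_bigr do rewrite mulr_sumr.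
rewrite exchange_big /=.
rewrite (eq_bigr (fun l => (a == l)%:R * dlog l x)) ?sum_delta_sym // => l _.
rewrite -(inv_metricr unit_g a l Ux) mulr_suml.
by apply: eq_bigr => k _; rewrite mulrA.
Qed.

(** Differentiating s^-2 g replaces each derivative of g by its value minus
    twice the logarithmic gradient times g; the factor s^-2 cancels against
    the inverse metric. *)
Lemma levi_civita_conformal x a c b : U x ->
  levi_civita (fun y => (s y) ^- 2 *: g y) x a c b =
  Gam x a c b + conf_change x a c b.
Proof.
move=> Ux; have s0 := s_neq0 Ux.
have sV : smooth U (fun y => (s y)^-1) by exact: smoothV.
have dg i k l : pd i (fun y => ((s y) ^- 2 *: g y) k l) x =
    (s x) ^- 2 * (pd i (fun y => g y k l) x - 2 * dlog i x * g x k l).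
  rewrite (eq_on_open_pd (g := fun y => (s y)^-1 * (s y)^-1 * g y k l) _ oU Ux).
    rewrite (pdM _ Ux (smoothM oU sV sV)) // (pdM _ Ux) // (pdV _ Ux) //.
    rewrite /dlog; move: (pd i s x) (pd i _ x) (g x k l) (s x) s0 => *.
    by field.
  by move=> y Uy; rewrite mxE -exprVn expr2.
have invE : invmx ((s x) ^- 2 *: g x) = (s x) ^+ 2 *: h x.
  by rewrite invmxZ ?invrK // unitmxZ ?unit_g // unitfE invr_neq0 // expf_neq0.
rewrite /levi_civita invE /conf_change /conf_diff /dlog_up.
rewrite (eq_bigr (fun e => h x c e *
    (pd a (fun y => g y b e) x + pd b (fun y => g y a e) x
       - pd e (fun y => g y a b) x)
  + (- (2 * dlog a x)) * (h x c e * g x e b)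
  + (- (2 * dlog b x)) * (h x c e * g x e a)
  + 2 * g x a b * (h x c e * dlog e x))); last first.
  move=> e _; rewrite mxE !dg (sym_g b e Ux) (sym_g a e Ux).
  move: (pd a _ x) (pd b _ x) (pd e _ x) (h x c e) (dlog a x) (dlog b x) (dlog e x).
  move: (g x a b) (g x e a) (g x e b) (s x) s0.
  by move=> gab gea geb t t0 *; field; rewrite t0.
rewrite !big_split /= -!mulr_sumr !(inv_metricl unit_g _ _ Ux).
by field.
Qed.

(** The coefficient of g in the change of the Ricci tensor; the trace-free
    part does not see it. *)
Definition conf_factor x : R :=
  \sum_a pd a (dlog_up a) x + \sum_k (\sum_a Gam x a a k) * dlog_up k x
  - (m%:R - 2) * \sum_k dlog k x * dlog_up k x.

Let pd_dlog a b x : U x ->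
  pd a (dlog b) x = pd a (pd b s) x / s x - dlog a x * dlog b x.
Proof.
move=> Ux; have s0 := s_neq0 Ux.
have sV : smooth U (fun y => (s y)^-1) by exact: smoothV.
rewrite (pdM _ Ux (smooth_pd b smooth_s) sV) (pdV _ Ux) // /dlog.
set p := pd a (pd b s) x; set q := pd a s x; set r := pd b s x; set t := s x in s0 *.
by field.
Qed.

Let pd_conf_change a c b i x : U x ->
  pd i (fun y => conf_change y a c b) x =
  pd i (fun y => g y a b) x * dlog_up c x + g x a b * pd i (dlog_up c) x
  - (c == b)%:R * pd i (dlog a) x - (c == a)%:R * pd i (dlog b) x.
Proof.
move=> Ux; rewrite /conf_change /conf_diff.
have sM j r : smooth U (fun y => dlog j y * r) by apply: smoothM => //; exact: smooth_cst.
have pdr j (r : R) : pd i (fun y => dlog j y * r) x = r * pd i (dlog j) x.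
  by rewrite (pdM _ Ux _ (smooth_cst U r)) // pd_cst mulr0 addr0 mulrC.
have sv := smoothM oU (smooth_g a b) (smooth_dlog_up c).
rewrite (pdB oU _ Ux (smoothD oU sv (smoothN oU (sM a _))) (sM b _)).
by rewrite (pdB oU _ Ux sv (sM a _)) (pdM _ Ux) // !pdr.
Qed.

(** The derivative terms of the logarithmic gradient combine, by symmetry of
    second derivatives, into (m - 2) times its covariant derivative; together
    with the quadratic term (m - 2) u u this is (m - 2) / s times the Hessian of
    s itself, which is what makes the Einstein condition linear in s. *)
Lemma ricci_conformal x b e : U x ->
  ricci (levi_civita (fun y => (s y) ^- 2 *: g y)) x b e =
  ricci Gam x b e + (m%:R - 2) / s x * hessian Gam s x b e
  + conf_factor x * g x b e.
Proof.
move=> Ux; have s0 := s_neq0 Ux.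
have sG a c k : smooth U (fun y => Gam y a c k) by exact: smooth_levi_civita.
rewrite (eq_ricci oU b e Ux (fun y Uy A C B => levi_civita_conformal A C B Uy)).
rewrite (ricciD b e Ux sG smooth_conf_change).
have lv a : \sum_k g x a k * dlog_up k x = dlog a x by exact: lower_dlog_up.
have gT a c : g x a c = g x c a by exact: sym_g.
have GT a c k : Gam x a c k = Gam x k c a by exact: (levi_civita_sym oU).
rewrite (conf_diff_quadratic gT lv) (conf_diff_cross gT lv b e GT).
have -> : \sum_a (\sum_k Gam x a k b * g x k e + \sum_k Gam x a k e * g x k b)
    * dlog_up a x = \sum_a pd a (fun y => g y b e) x * dlog_up a x.
  by apply: eq_bigr => a _; rewrite (metric_compat oU sym_g unit_g).
have -> : \sum_a pd b (fun y => conf_change y a a e) x = - m%:R * pd b (dlog e) x.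
  rewrite -(pd_sum oU _ _ Ux) // -(pdMl _ _ Ux) //.
  apply: (eq_on_open_pd _ oU Ux) => y Uy; rewrite mulNr.
  apply: conf_diff_trace => // [a c|a]; [exact: sym_g|exact: lower_dlog_up].
have contr (P V Q F1 F2 : 'I_m -> R) (r : R) :
    \sum_a (P a * V a + r * Q a - (a == e)%:R * F1 a - (a == b)%:R * F2 a) =
    \sum_a P a * V a + r * (\sum_a Q a) - F1 e - F2 b.
  by rewrite !sumrB big_split /= !sum_delta -mulr_sumr.
have -> : \sum_a pd a (fun y => conf_change y b a e) x =
    \sum_a pd a (fun y => g y b e) x * dlog_up a x
    + g x b e * (\sum_a pd a (dlog_up a) x) - pd e (dlog b) x - pd b (dlog e) x.
  rewrite (eq_bigr _ (fun a _ => pd_conf_change b a e a Ux)).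
  exact: (contr (fun a => pd a _ x) (dlog_up^~ x) (fun a => pd a (dlog_up a) x)
    (fun a => pd a (dlog b) x) (fun a => pd a (dlog e) x)).
rewrite !pd_dlog // (pdC e b oU smooth_s Ux) hessianE /conf_factor.
have -> : \sum_c Gam x b c e * pd c s x = s x * \sum_k Gam x b k e * dlog k x.
  by rewrite mulr_sumr; apply: eq_bigr => k _; rewrite /dlog; field.
move: (\sum_a _ * dlog_up a x) (\sum_k Gam x b k e * _) (\sum_k _ * dlog_up k x).
move: (\sum_k _ * _) (\sum_a _).
set A1 := pd b (pd e s) x; set A2 := ricci _ _ _ _; set A3 := dlog e x; set A4 := dlog b x.
move: A1 A2 A3 A4 (s x) (g x b e) s0 => A1 A2 A3 A4 S H S0 X1 X2 X3 X4 X5.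
by field.
Qed.

End Conformal.

Section EinsteinScale.
Context {R : realType} {m : nat}.

(** Contraction with the inverse metric shows that the only possible multiple of
    g is the scalar curvature divided by m. *)
Lemma einstein_pointP (g : 'rV[R]_m -> 'M[R]_m) x :
  m%:R != 0 :> R -> g x \in unitmx -> (g x)^T = g x ->
  (forall a b, ricci (levi_civita g) x a b
     - scalar_curvature g x / m%:R * g x a b = 0) <->
  (exists lam, forall a b, ricci (levi_civita g) x a b = lam * g x a b).
Proof.
move=> m0 ug gT; split=> [E|[lam E] a b].
  by exists (scalar_curvature g x / m%:R) => a b; apply/eqP; rewrite -subr_eq0 E.
suff -> : scalar_curvature g x = lam * m%:R by rewrite mulfK // E subrr.
rewrite /scalar_curvature; have gs a' b' : g x a' b' = g x b' a'.
  by rewrite -{1}gT mxE.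
have row_a a' : \sum_b' invmx (g x) a' b' * ricci (levi_civita g) x a' b' = lam.
  rewrite (eq_bigr (fun b' => lam * (invmx (g x) a' b' * g x b' a'))).
    rewrite -mulr_sumr; have /matrixP/(_ a' a') := mulVmx ug.
    by rewrite !mxE eqxx => ->; rewrite mulr1.
  by move=> b' _; rewrite E mulrCA (gs a').
by rewrite (eq_bigr _ (fun a' _ => row_a a')) sumr_const card_ord mulr_natr.
Qed.

Context (U : set 'rV[R]_m) (oU : open U).
Context (g : 'rV[R]_m -> 'M[R]_m) (s : 'rV[R]_m -> R).
Hypothesis smooth_g : forall a b, smooth U (fun x => g x a b).
Hypothesis smooth_inv : forall a b, smooth U (fun x => invmx (g x) a b).
Hypothesis sym_g : forall x a b, U x -> g x a b = g x b a.
Hypothesis unit_g : forall x, U x -> g x \in unitmx.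
Hypothesis smooth_s : smooth U s.
Hypothesis s_neq0 : forall x, U x -> s x != 0.
Hypothesis m_gt2 : (2 < m)%N.

(** The linear form of the Einstein condition; m > 2 is needed to divide by
    the coefficient of the Hessian. *)
Lemma einstein_conformalP x : U x ->
  (forall a b, ricci (levi_civita (fun y => (s y) ^- 2 *: g y)) x a b
     - scalar_curvature (fun y => (s y) ^- 2 *: g y) x / m%:R
       * ((s x) ^- 2 *: g x) a b = 0) <->
  (exists lam, forall a b, hessian (levi_civita g) s x a b
     + ricci (levi_civita g) x a b / (m%:R - 2) * s x = lam * g x a b).
Proof.
move=> Ux; have s0 := s_neq0 Ux.
have m0 : m%:R != 0 :> R by rewrite pnatr_eq0 -lt0n (ltn_trans _ m_gt2).
have m2 : m%:R - 2 != 0 :> R by rewrite subr_eq0 (eqr_nat R m 2) gtn_eqF.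
have sV : (s x) ^- 2 \is a GRing.unit by rewrite unitfE invr_neq0 // expf_neq0.
apply: (iff_trans (einstein_pointP m0 _ _)).
- by rewrite unitmxZ // unit_g.
- by apply/matrixP => a b; rewrite !mxE (sym_g _ _ Ux).
set mu := conf_factor g s x.
have rc a b := ricci_conformal oU smooth_g smooth_inv sym_g unit_g smooth_s s_neq0
  a b Ux.
split=> [[lam E]|[lam E]].
  exists ((lam / s x ^+ 2 - mu) * s x / (m%:R - 2)) => a b.
  have := E a b; rewrite rc mxE -/mu.
  move: (hessian _ _ _ _ _) (ricci _ _ _ _) (g x a b) (s x) s0 mu.
  move=> H r gab S S0 mu E'.
  have -> : r = lam * (S ^- 2 * gab) - (m%:R - 2) / S * H - mu * gab.
    by rewrite -E'; ring.
  by field; rewrite S0 m2.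
exists (((m%:R - 2) / s x * lam + mu) * s x ^+ 2) => a b.
have := E a b; rewrite rc mxE -/mu.
move: (hessian _ _ _ _ _) (ricci _ _ _ _) (g x a b) (s x) s0 mu.
move=> H r gab S S0 mu E'.
have -> : H = lam * gab - r / (m%:R - 2) * S by rewrite -E'; ring.
by field; rewrite S0 m2.
Qed.

End EinsteinScale.

(** * Vector fields with pure-trace derivative *)

Section ScalarDerivative.
Context {R : realType} {n : nat} (U : set 'rV[R]_n) (oU : open U).
Context (G : christoffel R n) (xi : 'rV[R]_n -> 'rV[R]_n) (lam : 'rV[R]_n -> R).
Hypothesis smooth_G : forall A C B, smooth U (fun x => G x A C B).
Hypothesis sym_G : forall x A C B, U x -> G x A C B = G x B C A.
Hypothesis smooth_xi : forall A, smooth U (fun x => xi x 0 A).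
Hypothesis smooth_lam : smooth U lam.
Hypothesis nabla_xi : forall x A B, U x ->
  nabla_vec G xi x A B = lam x * (A == B)%:R.

Let pd_xi x B K : U x ->
  pd B (fun y => xi y 0 K) x = lam x * (B == K)%:R - \sum_C G x B K C * xi x 0 C.
Proof. by move=> Ux; rewrite -nabla_xi // /nabla_vec addrK. Qed.

Let pd_pd_xi x A B K : U x ->
  pd A (pd B (fun y => xi y 0 K)) x =
  pd A lam x * (B == K)%:R - \sum_C pd A (fun y => G y B K C) x * xi x 0 C
  - lam x * G x B K A + \sum_C (\sum_E G x B K E * G x A E C) * xi x 0 C.
Proof.
move=> Ux; have sGx C : smooth U (fun y => G y B K C * xi y 0 C) by exact: smoothM.
have sd : smooth U (fun y => lam y * (B == K)%:R).
  by apply: smoothM => //; exact: smooth_cst.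
rewrite (eq_on_open_pd _ oU Ux (fun y Uy => pd_xi B K Uy)).
rewrite (pdB oU _ Ux sd (smooth_sum oU _ sGx)) (pd_sum oU _ _ Ux sGx).
rewrite (pdM _ Ux smooth_lam (smooth_cst U _)) pd_cst mulr0 addr0 -!addrA.
congr (_ + _).
rewrite (eq_bigr (fun C => pd A (fun y => G y B K C) x * xi x 0 C
   + (lam x * ((A == C)%:R * G x B K C) -
      G x B K C * \sum_E G x A C E * xi x 0 E))); last first.
  move=> C _; rewrite (pdM _ Ux (smooth_G B K C) (smooth_xi C)) pd_xi //.
  by congr (_ + _); rewrite mulrBr; congr (_ - _); ring.
rewrite big_split sumrB /= -mulr_sumr sum_delta_sym !opprD opprK.
congr (_ + (_ + _)).
under eq_bigr do rewrite mulr_sumr.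
rewrite exchange_big /=; apply: eq_bigr => C _; rewrite mulr_suml.
by apply: eq_bigr => E _; rewrite mulrA.
Qed.

(** The second derivatives of xi are expressed through lam and the connection
    by the hypothesis; their symmetry is the Ricci identity for xi. *)
Lemma ricci_identity_pure_trace x A B K : U x ->
  pd A lam x * (B == K)%:R - pd B lam x * (A == K)%:R =
  \sum_C curvature G x A B K C * xi x 0 C.
Proof.
move=> Ux; have Z := pdC A B oU (smooth_xi K) Ux.
rewrite !pd_pd_xi // (sym_G B K A Ux) in Z.
rewrite (eq_bigr (fun C => pd A (fun y => G y B K C) x * xi x 0 C
   - pd B (fun y => G y A K C) x * xi x 0 C
   + ((\sum_E G x A K E * G x B E C) * xi x 0 C
   - (\sum_E G x B K E * G x A E C) * xi x 0 C))); last first.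
  by move=> C _; rewrite /curvature sumrB; ring.
rewrite big_split !sumrB /=; move: Z.
move: (\sum_C pd A _ _ * _) (\sum_C pd B _ _ * _).
move: (\sum_C (\sum_E G x B K E * _) * _) (\sum_C (\sum_E G x A K E * _) * _).
move: (pd A lam x * _) (pd B lam x * _) (lam x * _) => a b c d e f h /eqP.
rewrite -subr_eq0 => /eqP Z.
by apply/eqP; rewrite -subr_eq0 -Z; apply/eqP; ring.
Qed.

(** Contraction of the Ricci identity: the derivative of the trace factor is
    determined algebraically by xi. *)
Lemma pd_trace_factor x B : (2 <= n)%N -> U x ->
  pd B lam x = - \sum_C proj_schouten G x B C * xi x 0 C.
Proof.
move=> n2 Ux; have n1 : n%:R - 1 != 0 :> R by rewrite subr_eq0 (eqr_nat R n 1) gtn_eqF.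
have E : \sum_A (pd A lam x * (B == A)%:R - pd B lam x * (A == A)%:R) =
    \sum_C ricci G x B C * xi x 0 C.
  under eq_bigr do rewrite ricci_identity_pure_trace //.
  by rewrite exchange_big; apply: eq_bigr => C _; rewrite -mulr_suml.
have {E} : (1 - n%:R) * pd B lam x = \sum_C ricci G x B C * xi x 0 C.
  rewrite -E sumrB; under [X in _ = X - _]eq_bigr do rewrite mulrC.
  rewrite sum_delta_sym; under eq_bigr do rewrite eqxx mulr1.
  by rewrite sumr_const card_ord -mulr_natl; ring.
move=> E; apply: (mulfI (_ : 1 - n%:R != 0)).
  by rewrite -opprB oppr_eq0.
rewrite E mulrN -mulNr opprB mulr_sumr; apply: eq_bigr => C _.
rewrite /proj_schouten; move: (ricci _ _ _ _) (n%:R) n1 => r N n1.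
by field.
Qed.

(** The coefficient of p_K in the (x^A, x^B)-component of the almost Einstein
    equation for the fibrewise affine function with linear part xi. *)
Definition momentum_coef x A B K : R :=
  pd A (pd B (fun y => xi y 0 K)) x
  - \sum_C G x A C B * pd C (fun y => xi y 0 K) x
  + \sum_C (pd A (fun y => G y B K C) x + pd B (fun y => G y A K C) x
            - pd C (fun y => G y A K B) x) * xi x 0 C
  - 2 * (\sum_C (\sum_E G x C K E * G x A E B) * xi x 0 C)
  + proj_schouten G x A B * xi x 0 K + 2 * lam x * G x A K B.

(** Second derivatives of xi and the derivative of lam are eliminated; what
    remains is the projective Weyl tensor, whose two Schouten terms come from the
    derivative of lam and from the zero-order term of the equation. *)
Lemma momentum_coefE x A B K : (2 <= n)%N -> U x ->
  (forall A B, ricci G x A B = ricci G x B A) ->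
  momentum_coef x A B K = - \sum_C xi x 0 C * proj_weyl G x C B K A.
Proof.
move=> n2 Ux ricS; have PS C D : proj_schouten G x C D = proj_schouten G x D C.
  by rewrite /proj_schouten ricS.
have Wsum : \sum_C xi x 0 C * proj_weyl G x C B K A =
    \sum_C pd C (fun y => G y A K B) x * xi x 0 C
    - \sum_C pd B (fun y => G y A K C) x * xi x 0 C
    + \sum_C (\sum_E G x C K E * G x A E B) * xi x 0 C
    - \sum_C (\sum_E G x B K E * G x A E C) * xi x 0 C
    - pd A lam x * (B == K)%:R - proj_schouten G x A B * xi x 0 K.
  rewrite (pd_trace_factor A n2 Ux) mulNr opprK -[X in _ - X](sum_delta_sym
    (fun C => proj_schouten G x A B * xi x 0 C)) mulr_suml.
  rewrite -!(sumrB, big_split) /=; apply: eq_bigr => C _.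
  rewrite /proj_weyl /curvature sumrB (PS C A) (PS B A).
  have -> : pd C (fun y => G y B K A) x = pd C (fun y => G y A K B) x.
    by apply: (eq_on_open_pd _ oU Ux) => y Uy; exact: sym_G.
  have -> : pd B (fun y => G y C K A) x = pd B (fun y => G y A K C) x.
    by apply: (eq_on_open_pd _ oU Ux) => y Uy; exact: sym_G.
  have -> : \sum_E G x C K E * G x B E A = \sum_E G x C K E * G x A E B.
    by apply: eq_bigr => E _; rewrite (sym_G B E A Ux).
  have -> : \sum_E G x B K E * G x C E A = \sum_E G x B K E * G x A E C.
    by apply: eq_bigr => E _; rewrite (sym_G C E A Ux).
  rewrite (eq_sym B K).
  move: (pd C _ _) (pd B _ _) (\sum_E _) (\sum_E _) (proj_schouten _ _ _ _).
  move: (proj_schouten _ _ _ _) (xi x 0 C) (K == B)%:R (K == C)%:R.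
  by move=> a b c d e f h i j; ring.
rewrite Wsum /momentum_coef pd_pd_xi //.
have -> : \sum_C G x A C B * pd C (fun y => xi y 0 K) x =
    lam x * G x A K B - \sum_C (\sum_E G x C K E * G x A E B) * xi x 0 C.
  rewrite (eq_bigr (fun C => lam x * ((C == K)%:R * G x A C B)
     - G x A C B * \sum_E G x C K E * xi x 0 E)); last first.
    by move=> C _; rewrite pd_xi //; ring.
  rewrite sumrB -mulr_sumr sum_delta; congr (_ - _).
  under eq_bigr do rewrite mulr_sumr.
  rewrite exchange_big /=; apply: eq_bigr => C _; rewrite mulr_suml.
  by apply: eq_bigr => E _; rewrite (sym_G C K E Ux); ring.
have -> : \sum_C (pd A (fun y => G y B K C) x + pd B (fun y => G y A K C) x
      - pd C (fun y => G y A K B) x) * xi x 0 C =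
    \sum_C pd A (fun y => G y B K C) x * xi x 0 C
    + \sum_C pd B (fun y => G y A K C) x * xi x 0 C
    - \sum_C pd C (fun y => G y A K B) x * xi x 0 C.
  by rewrite -big_split -sumrB /=; apply: eq_bigr => C _; ring.
rewrite (sym_G B K A Ux).
move: (\sum_C pd A _ _ * _) (\sum_C pd B _ _ * _) (\sum_C pd C _ _ * _).
move: (\sum_C (\sum_E G x B K E * _) * _) (\sum_C (\sum_E G x C K E * _) * _).
move: (pd A lam x) (proj_schouten _ _ _ _) (lam x) (G x A K B) (xi x 0 K).
by move: (B == K)%:R => r; move=> *; ring.
Qed.

End ScalarDerivative.

(** * The modified Patterson-Walker metric *)

Section PattersonWalker.
Context {R : realType} {n : nat} (U : set 'rV[R]_n) (oU : open U).
Context (G : christoffel R n) (Phi : 'rV[R]_n -> 'M[R]_n).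
Hypothesis smooth_G : forall A C B, smooth U (fun x => G x A C B).
Hypothesis smooth_Phi : forall A B, smooth U (fun x => Phi x A B).
Hypothesis sym_G : forall x A C B, U x -> G x A C B = G x B C A.
Hypothesis sym_Phi : forall x A B, U x -> Phi x A B = Phi x B A.

(* In lemma names, x marks a base index (lshift) and p a momentum index (rshift). *)

Definition cotangent_over : set 'rV[R]_(n + n) := [set z | U (lsubmx z)].

Local Notation pU := cotangent_over.
Local Notation pt z := (lsubmx z).
Local Notation lft := (lshift n).
Local Notation rgt := (@rshift n n).

Definition base_block A B (z : 'rV[R]_(n + n)) : R :=
  - 2 * (\sum_C G (pt z) A C B * rsubmx z 0 C) + Phi (pt z) A B.

(** The modified Patterson-Walker metric over a single coordinate domain, so that
    all computations can ignore the atlas. *)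
Definition mpw_metric (z : 'rV[R]_(n + n)) : 'M[R]_(n + n) :=
  block_mx (\matrix_(A, B) base_block A B z) 1%:M 1%:M 0.

Local Notation g := mpw_metric.
Local Notation S := base_block.
Local Notation LC := (levi_civita g).

Lemma open_cotangent_over : open pU.
Proof. by apply: open_comp oU => z _; exact: continuous_lsubmx. Qed.

Let opU := open_cotangent_over.

Lemma smooth_pullback f : smooth U f -> smooth pU (fun z => f (pt z)).
Proof. exact: smooth_lsubmx. Qed.

Lemma smooth_momentum C : smooth pU (fun z : 'rV[R]_(n + n) => rsubmx z 0 C).
Proof.
by apply: eq_smooth (smooth_coord (rgt C) _) => // z _; rewrite mxE.
Qed.

Lemma pd_momentum_fibre A C z : pd (rgt A) (fun z : 'rV[R]_(n + n) => rsubmx z 0 C) z = (A == C)%:R.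
Proof.
have -> : (fun z : 'rV[R]_(n + n) => rsubmx z 0 C) = (fun z => z 0 (rgt C)).
  by apply/funext => y; rewrite mxE.
by rewrite pd_coord eq_rshift.
Qed.

Lemma pd_momentum_base A C z : pd (lft A) (fun z : 'rV[R]_(n + n) => rsubmx z 0 C) z = 0.
Proof.
have -> : (fun z : 'rV[R]_(n + n) => rsubmx z 0 C) = (fun z => z 0 (rgt C)).
  by apply/funext => y; rewrite mxE.
by rewrite pd_coord eq_lrshift.
Qed.

Lemma smooth_affine (a : 'I_n -> 'rV[R]_n -> R) (b : 'rV[R]_n -> R) :
  (forall C, smooth U (a C)) -> smooth U b ->
  smooth pU (fun z => \sum_C a C (pt z) * rsubmx z 0 C + b (pt z)).
Proof.
move=> sa sb; apply: smoothD => //; last exact: smooth_pullback.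
apply: smooth_sum => // C; apply: smoothM => //; last exact: smooth_momentum.
exact: smooth_pullback.
Qed.

Lemma pd_affine_base (a : 'I_n -> 'rV[R]_n -> R) (b : 'rV[R]_n -> R) A z :
  (forall C, smooth U (a C)) -> smooth U b -> pU z ->
  pd (lft A) (fun z => \sum_C a C (pt z) * rsubmx z 0 C + b (pt z)) z =
  \sum_C pd A (a C) (pt z) * rsubmx z 0 C + pd A b (pt z).
Proof.
move=> sa sb Uz.
have sm C : smooth pU (fun z => a C (pt z) * rsubmx z 0 C).
  apply: smoothM => //; last exact: smooth_momentum; exact: smooth_pullback.
rewrite (pdD _ Uz (smooth_sum opU _ sm) (smooth_pullback sb)) pd_lsubmx.
rewrite (pd_sum opU _ _ Uz sm); congr (_ + _); apply: eq_bigr => C _.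
rewrite (pdM _ Uz (smooth_pullback (sa C)) (smooth_momentum C)).
by rewrite pd_lsubmx pd_momentum_base mulr0 addr0.
Qed.

Lemma pd_affine_fibre (a : 'I_n -> 'rV[R]_n -> R) (b : 'rV[R]_n -> R) A z :
  (forall C, smooth U (a C)) -> smooth U b -> pU z ->
  pd (rgt A) (fun z => \sum_C a C (pt z) * rsubmx z 0 C + b (pt z)) z =
  a A (pt z).
Proof.
move=> sa sb Uz.
have sm C : smooth pU (fun z => a C (pt z) * rsubmx z 0 C).
  apply: smoothM => //; last exact: smooth_momentum; exact: smooth_pullback.
rewrite (pdD _ Uz (smooth_sum opU _ sm) (smooth_pullback sb)) pd_lsubmx0 addr0.
rewrite (pd_sum opU _ _ Uz sm) -[RHS](sum_delta_sym (fun C => a C (pt z))).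
apply: eq_bigr => C _.
rewrite (pdM _ Uz (smooth_pullback (sa C)) (smooth_momentum C)).
by rewrite pd_lsubmx0 pd_momentum_fibre mul0r add0r mulrC.
Qed.

Let base_blockE A B z : S A B z =
  \sum_C (- 2 * G (pt z) A C B) * rsubmx z 0 C + Phi (pt z) A B.
Proof. by rewrite /S mulr_sumr; congr (_ + _); apply: eq_bigr => C _; rewrite mulrA. Qed.

Let sG2 A B C : smooth U (fun x => - 2 * G x A C B).
Proof. by apply: smoothM => //; exact: smooth_cst. Qed.

Lemma smooth_base_block A B : smooth pU (S A B).
Proof.
apply: eq_smooth opU (fun z _ => esym (base_blockE A B z)) _.
exact: (smooth_affine (sG2 A B) (smooth_Phi A B)).
Qed.

Lemma base_block_sym A B z : pU z -> S A B z = S B A z.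
Proof.
move=> Uz; rewrite /S sym_Phi //; congr (_ * _ + _).
by apply: eq_bigr => C _; rewrite sym_G.
Qed.

(** The momentum derivative of the metric is the given connection; this is how
    the affine geometry of the base enters the Levi-Civita connection. *)
Lemma pd_base_block_fibre A B C z : pU z -> pd (rgt C) (S A B) z = - 2 * G (pt z) A C B.
Proof.
move=> Uz; rewrite (eq_on_open_pd _ opU Uz (fun z _ => base_blockE A B z)).
exact: (pd_affine_fibre C (sG2 A B) (smooth_Phi A B) Uz).
Qed.

Lemma pd_base_block_base A B E z : pU z -> pd (lft E) (S A B) z =
  - 2 * (\sum_C pd E (fun x => G x A C B) (pt z) * rsubmx z 0 C)
  + pd E (fun x => Phi x A B) (pt z).
Proof.
move=> Uz; rewrite (eq_on_open_pd _ opU Uz (fun z _ => base_blockE A B z)).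
rewrite (pd_affine_base E (sG2 A B) (smooth_Phi A B) Uz); congr (_ + _).
rewrite mulr_sumr; apply: eq_bigr => C _.
by rewrite (pdMl (-2) E Uz (smooth_G A C B)) mulrA.
Qed.

Definition mpw_inverse (z : 'rV[R]_(n + n)) : 'M[R]_(n + n) :=
  block_mx 0 1%:M 1%:M (- \matrix_(A, B) S A B z).

Lemma mpw_metricK z : g z *m mpw_inverse z = 1%:M.
Proof.
rewrite /g /mpw_inverse mulmx_block !mulmx0 !mul0mx !mul1mx !mulmx1.
by rewrite !add0r addr0 subrr -scalar_mx_block.
Qed.

Lemma unit_mpw_metric z : g z \in unitmx.
Proof. by have [] := mulmx1_unit (mpw_metricK z). Qed.

Lemma invmx_mpw_metric z : invmx (g z) = mpw_inverse z.
Proof.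
by rewrite -[LHS]mulmx1 -(mpw_metricK z) mulmxA mulVmx ?mul1mx ?unit_mpw_metric.
Qed.

Let gxx A B z : g z (lft A) (lft B) = S A B z.
Proof. by rewrite block_mxEul mxE. Qed.
Let gxp A B z : g z (lft A) (rgt B) = (A == B)%:R.
Proof. by rewrite block_mxEur mxE. Qed.
Let gpx A B z : g z (rgt A) (lft B) = (A == B)%:R.
Proof. by rewrite block_mxEdl mxE. Qed.
Let gpp A B z : g z (rgt A) (rgt B) = 0.
Proof. by rewrite block_mxEdr mxE. Qed.
Let hxx A B z : invmx (g z) (lft A) (lft B) = 0.
Proof. by rewrite invmx_mpw_metric block_mxEul mxE. Qed.
Let hxp A B z : invmx (g z) (lft A) (rgt B) = (A == B)%:R.
Proof. by rewrite invmx_mpw_metric block_mxEur mxE. Qed.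
Let hpx A B z : invmx (g z) (rgt A) (lft B) = (A == B)%:R.
Proof. by rewrite invmx_mpw_metric block_mxEdl mxE. Qed.
Let hpp A B z : invmx (g z) (rgt A) (rgt B) = - S A B z.
Proof. by rewrite invmx_mpw_metric block_mxEdr !mxE. Qed.

Lemma smooth_mpw_metric a b : smooth pU (fun z => g z a b).
Proof.
case: (split_ordP a) => A ->; case: (split_ordP b) => B ->.
- by apply: eq_smooth opU (fun z _ => esym (gxx A B z)) _; exact: smooth_base_block.
- by apply: eq_smooth opU (fun z _ => esym (gxp A B z)) _; exact: smooth_cst.
- by apply: eq_smooth opU (fun z _ => esym (gpx A B z)) _; exact: smooth_cst.
- by apply: eq_smooth opU (fun z _ => esym (gpp A B z)) _; exact: smooth_cst.
Qed.

Lemma smooth_mpw_inverse a b : smooth pU (fun z => invmx (g z) a b).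
Proof.
case: (split_ordP a) => A ->; case: (split_ordP b) => B ->.
- by apply: eq_smooth opU (fun z _ => esym (hxx A B z)) _; exact: smooth_cst.
- by apply: eq_smooth opU (fun z _ => esym (hxp A B z)) _; exact: smooth_cst.
- by apply: eq_smooth opU (fun z _ => esym (hpx A B z)) _; exact: smooth_cst.
- apply: eq_smooth opU (fun z _ => esym (hpp A B z)) _; apply: smoothN => //.
  exact: smooth_base_block.
Qed.

Lemma sym_mpw_metric z a b : pU z -> g z a b = g z b a.
Proof.
move=> Uz; case: (split_ordP a) => A ->; case: (split_ordP b) => B ->.
- by rewrite !gxx base_block_sym.
- by rewrite gxp gpx eq_sym.
- by rewrite gxp gpx eq_sym.
- by rewrite !gpp.
Qed.

Let pdgxx c A B z : pd c (fun y => g y (lft A) (lft B)) z = pd c (S A B) z.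
Proof. by congr (pd c _ z); apply/funext => y; rewrite gxx. Qed.
Let pdgxp c A B z : pd c (fun y => g y (lft A) (rgt B)) z = 0.
Proof.
by rewrite -(pd_cst (A == B)%:R c z); congr (pd c _ z); apply/funext => y; rewrite gxp.
Qed.
Let pdgpx c A B z : pd c (fun y => g y (rgt A) (lft B)) z = 0.
Proof.
by rewrite -(pd_cst (A == B)%:R c z); congr (pd c _ z); apply/funext => y; rewrite gpx.
Qed.
Let pdgpp c A B z : pd c (fun y => g y (rgt A) (rgt B)) z = 0.
Proof.
by rewrite -(pd_cst 0 c z); congr (pd c _ z); apply/funext => y; rewrite gpp.
Qed.

Let pdgE := (pdgxx, pdgxp, pdgpx, pdgpp).

Let raise_base C (F : 'I_(n + n) -> R) z :
  \sum_k invmx (g z) (lft C) k * F k = F (rgt C).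
Proof.
rewrite big_split_ord /= [X in X + _]big1 ?add0r => [|i _]; last by rewrite hxx mul0r.
by under eq_bigr do rewrite hxp; rewrite sum_delta_sym.
Qed.

Let raise_fibre C (F : 'I_(n + n) -> R) z :
  \sum_k invmx (g z) (rgt C) k * F k = F (lft C) - \sum_E S C E z * F (rgt E).
Proof.
rewrite big_split_ord /= -sumrN; congr (_ + _).
  by under eq_bigr do rewrite hpx; rewrite sum_delta_sym.
by apply: eq_bigr => E _; rewrite hpp mulNr.
Qed.

Let christoffel_up_x a C b z : LC z a (lft C) b =
  2^-1 * (pd a (fun y => g y b (rgt C)) z + pd b (fun y => g y a (rgt C)) z
          - pd (rgt C) (fun y => g y a b) z).
Proof. exact: (congr1 _ (raise_base C _ z)). Qed.

Let christoffel_up_p a C b z : LC z a (rgt C) b =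
  2^-1 * (pd a (fun y => g y b (lft C)) z + pd b (fun y => g y a (lft C)) z
          - pd (lft C) (fun y => g y a b) z)
  - \sum_E S C E z * LC z a (lft E) b.
Proof.
rewrite [LHS](congr1 _ (raise_fibre C _ z)) mulrBr; congr (_ - _).
by rewrite mulr_sumr; apply: eq_bigr => E _; rewrite christoffel_up_x mulrCA.
Qed.

Lemma mpw_christoffel_xxx A C B z : pU z -> LC z (lft A) (lft C) (lft B) = G (pt z) A C B.
Proof.
by move=> Uz; rewrite christoffel_up_x !pdgE pd_base_block_fibre //; field.
Qed.

Lemma mpw_christoffel_xxp A C B z : pU z -> LC z (lft A) (lft C) (rgt B) = 0.
Proof. by move=> Uz; rewrite christoffel_up_x !pdgE; ring. Qed.

Lemma mpw_christoffel_pxx A C B z : pU z -> LC z (rgt A) (lft C) (lft B) = 0.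
Proof. by move=> Uz; rewrite christoffel_up_x !pdgE; ring. Qed.

Lemma mpw_christoffel_pp A c B z : pU z -> LC z (rgt A) c (rgt B) = 0.
Proof.
move=> Uz; case: (split_ordP c) => C ->; rewrite ?christoffel_up_p.
  by rewrite christoffel_up_x !pdgE; ring.
rewrite big1 => [|E _]; rewrite ?christoffel_up_x !pdgE; ring.
Qed.

Lemma mpw_christoffel_xpx A C B z : pU z -> LC z (lft A) (rgt C) (lft B) =
  2^-1 * (pd (lft A) (S B C) z + pd (lft B) (S A C) z - pd (lft C) (S A B) z)
  - \sum_E S C E z * G (pt z) A E B.
Proof.
move=> Uz; rewrite christoffel_up_p !pdgE; congr (_ - _); apply: eq_bigr => E _.
by rewrite mpw_christoffel_xxx.
Qed.

Lemma mpw_christoffel_xpp A C B z : pU z -> LC z (lft A) (rgt C) (rgt B) = - G (pt z) A B C.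
Proof.
move=> Uz; rewrite christoffel_up_p !pdgE pd_base_block_fibre // big1 => [|E _].
  by field.
by rewrite mpw_christoffel_xxp // mulr0.
Qed.

Lemma mpw_christoffel_ppx A C B z : pU z -> LC z (rgt A) (rgt C) (lft B) = - G (pt z) B A C.
Proof.
move=> Uz; rewrite christoffel_up_p !pdgE pd_base_block_fibre // big1 => [|E _].
  by field.
by rewrite mpw_christoffel_pxx // mulr0.
Qed.

Lemma smooth_mpw_christoffel a c b : smooth pU (fun z => LC z a c b).
Proof.
exact: (smooth_levi_civita opU smooth_mpw_metric smooth_mpw_inverse).
Qed.

(** The coordinate volume of the metric is constant: the contributions of the
    base and of the dual momentum directions cancel. *)
Lemma mpw_christoffel_trace k z : pU z -> \sum_a LC z a a k = 0.
Proof.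
move=> Uz; rewrite big_split_ord /=; case: (split_ordP k) => K ->.
  rewrite -big_split big1 // => A _ /=.
  by rewrite mpw_christoffel_xxx // mpw_christoffel_ppx // (sym_G _ _ _ Uz) subrr.
by rewrite !big1 ?addr0 // => A _; rewrite ?mpw_christoffel_xxp ?mpw_christoffel_pp.
Qed.

Lemma mpw_ricciE b e z : pU z -> ricci LC z b e =
  \sum_a pd a (fun y => LC y b a e) z - \sum_a \sum_k LC z b a k * LC z a k e.
Proof.
move=> Uz; apply: (ricci_unimodular opU) => //; first exact: smooth_mpw_christoffel.
by move=> y k; exact: mpw_christoffel_trace.
Qed.

Lemma mpw_ricci_pp B E z : pU z -> ricci LC z (rgt B) (rgt E) = 0.
Proof.
move=> Uz; rewrite mpw_ricciE // big1 ?sub0r => [|a _]; last first.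
  by rewrite (eq_on_open_pd _ opU Uz (fun y Uy => mpw_christoffel_pp B a E Uy)) pd_cst.
rewrite big1 ?oppr0 // => a _; rewrite big1 // => k _.
case: (split_ordP k) => K ->; last by rewrite mpw_christoffel_pp // mul0r.
case: (split_ordP a) => A ->; first by rewrite mpw_christoffel_pxx // mul0r.
by rewrite [X in _ * X]mpw_christoffel_pp // mulr0.
Qed.

Lemma mpw_ricci_xp B E z : pU z -> ricci LC z (lft B) (rgt E) = 0.
Proof.
move=> Uz; rewrite mpw_ricciE // big_split_ord /= !big1 ?addr0 ?subr0 //.
- move=> a _; rewrite big1 // => k _.
  case: (split_ordP a) => A ->; last by rewrite [X in _ * X]mpw_christoffel_pp // mulr0.
  case: (split_ordP k) => K ->; first by rewrite [X in _ * X]mpw_christoffel_xxp // mulr0.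
  by rewrite mpw_christoffel_xxp // mul0r.
- move=> A _; rewrite (eq_on_open_pd _ opU Uz (fun y Uy => mpw_christoffel_xpp B A E Uy)).
  by rewrite (pd_lsubmx0 (fun x => - G x B E A)).
- move=> A _.
  by rewrite (eq_on_open_pd _ opU Uz (fun y Uy => mpw_christoffel_xxp B A E Uy)) pd_cst.
Qed.

Lemma mpw_ricci_px B E z : pU z -> ricci LC z (rgt B) (lft E) = 0.
Proof.
move=> Uz; rewrite mpw_ricciE // big_split_ord /= !big1 ?addr0 ?subr0 //.
- move=> a _; rewrite big1 // => k _.
  case: (split_ordP k) => K ->; last by rewrite mpw_christoffel_pp // mul0r.
  case: (split_ordP a) => A ->; first by rewrite mpw_christoffel_pxx // mul0r.
  by rewrite [X in _ * X]mpw_christoffel_pxx // mulr0.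
- move=> A _; rewrite (eq_on_open_pd _ opU Uz (fun y Uy => mpw_christoffel_ppx B A E Uy)).
  by rewrite (pd_lsubmx0 (fun x => - G x E B A)).
- move=> A _.
  by rewrite (eq_on_open_pd _ opU Uz (fun y Uy => mpw_christoffel_pxx B A E Uy)) pd_cst.
Qed.

(* Momentum derivatives of base derivatives of the metric are evaluated by
   exchanging the order, the momentum derivative being a connection coefficient. *)
Let pd_christoffel_xpx B A E z : pU z ->
  pd (rgt A) (fun y => LC y (lft B) (rgt A) (lft E)) z =
  pd A (fun x => G x B A E) (pt z) - pd B (fun x => G x A A E) (pt z)
  - pd E (fun x => G x A A B) (pt z) + 2 * \sum_F G (pt z) A A F * G (pt z) B F E.
Proof.
move=> Uz.
have sS A' B' c : smooth pU (pd c (S A' B')) by apply/smooth_pd/smooth_base_block.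
have sSG F : smooth pU (fun y => S A F y * G (pt y) B F E).
  by apply: smoothM => //; [exact: smooth_base_block|exact: (smooth_pullback (smooth_G B F E))].
have dS A' B' C : pd (rgt A) (pd (lft C) (S A' B')) z =
    - 2 * pd C (fun x => G x A' A B') (pt z).
  rewrite (pdC _ _ opU (smooth_base_block A' B') Uz).
  rewrite (eq_on_open_pd _ opU Uz (fun y Uy => pd_base_block_fibre A' B' A Uy)).
  by rewrite (pd_lsubmx (fun x => - 2 * G x A' A B')) (pdMl (-2) C Uz (smooth_G _ _ _)).
rewrite (eq_on_open_pd _ opU Uz (fun y Uy => mpw_christoffel_xpx B A E Uy)).
have s1 := smoothD opU (sS E A (lft B)) (sS B A (lft E)).
have s2 := smoothD opU s1 (smoothN opU (sS B E (lft A))).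
rewrite (pdB opU _ Uz (smoothM opU (smooth_cst _ _) s2) (smooth_sum opU _ sSG)).
rewrite (pdMl _ _ Uz s2) (pdB opU _ Uz s1 (sS B E (lft A))).
rewrite (pdD _ Uz (sS E A (lft B)) (sS B A (lft E))) !dS (pd_sum opU _ _ Uz sSG).
have sgn X C : pd X (fun x => G x C A A) (pt z) = pd X (fun x => G x A A C) (pt z).
  by apply: (eq_on_open_pd _ oU Uz) => y Uy; exact: sym_G.
rewrite !sgn (eq_bigr (fun F => - 2 * (G (pt z) A A F * G (pt z) B F E))).
  rewrite -mulr_sumr; move: (pd A _ _) (pd B _ _) (pd E _ _) (\sum_i _).
  by move=> a b c d; field.
move=> F _; rewrite (pdM _ Uz (smooth_base_block A F) (smooth_pullback (smooth_G B F E))).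
by rewrite (pd_lsubmx0 (fun x => G x B F E)) pd_base_block_fibre //; ring.
Qed.

(** Only the horizontal block of the Ricci tensor survives, and it is twice the
    symmetrized Ricci tensor of the connection, independent of Phi. *)
Lemma mpw_ricci_xx B E z : pU z ->
  ricci LC z (lft B) (lft E) = ricci G (pt z) B E + ricci G (pt z) E B.
Proof.
move=> Uz; rewrite mpw_ricciE // !big_split_ord /=.
under [X in _ + X - _]eq_bigr do rewrite pd_christoffel_xpx //.
rewrite (eq_bigr (fun A => pd A (fun x => G x B A E) (pt z))); last first.
  move=> A _; rewrite (eq_on_open_pd _ opU Uz (fun y Uy => mpw_christoffel_xxx B A E Uy)).
  exact: (pd_lsubmx (fun x => G x B A E)).
have -> : \sum_A \sum_k LC z (lft B) (lft A) k * LC z (lft A) k (lft E) =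
    \sum_A \sum_K G (pt z) B A K * G (pt z) A K E.
  apply: eq_bigr => A _; rewrite big_split_ord /= [X in _ + X]big1 ?addr0.
    by apply: eq_bigr => K _; rewrite !mpw_christoffel_xxx.
  by move=> K _; rewrite mpw_christoffel_xxp // mul0r.
have -> : \sum_A \sum_k LC z (lft B) (rgt A) k * LC z (rgt A) k (lft E) =
    \sum_A \sum_K G (pt z) E A K * G (pt z) A K B.
  apply: eq_bigr => A _; rewrite big_split_ord /=.
  rewrite big1 ?add0r => [|K _]; last by rewrite mpw_christoffel_pxx // mulr0.
  apply: eq_bigr => K _; rewrite mpw_christoffel_xpp // mpw_christoffel_ppx //.
  by rewrite (sym_G B K A Uz); ring.
rewrite /ricci /curvature.
have dsym : \sum_A pd A (fun x => G x E A B) (pt z) =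
    \sum_A pd A (fun x => G x B A E) (pt z).
  apply: eq_bigr => A _; apply: (eq_on_open_pd _ oU Uz) => y Uy; exact: sym_G.
have qsym : \sum_A \sum_K G (pt z) A A K * G (pt z) E K B =
    \sum_A \sum_K G (pt z) A A K * G (pt z) B K E.
  by apply: eq_bigr => A _; apply: eq_bigr => K _; rewrite (sym_G E K B Uz).
rewrite !big_split /= !sumrN dsym.
under [X in _ = _ - _ + X + _]eq_bigr do rewrite sumrB.
under [X in _ = _ + (_ + X)]eq_bigr do rewrite sumrB.
rewrite !sumrB qsym -mulr_sumr.
move: (\sum_A pd A _ _) (\sum_A pd B _ _) (\sum_A pd E _ _).
move: (\sum_A \sum_K G (pt z) A A K * _) (\sum_A \sum_K G (pt z) B A K * _).
move: (\sum_A \sum_K G (pt z) E A K * _).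
by move=> a b c d e f; ring.
Qed.

Lemma mpw_hessian_pp f A B z : pU z ->
  hessian LC f z (rgt A) (rgt B) = pd (rgt A) (pd (rgt B) f) z.
Proof.
move=> Uz; rewrite hessianE [X in _ - X]big1 ?subr0 // => c _.
by rewrite mpw_christoffel_pp // mul0r.
Qed.

Lemma mpw_hessian_xp f A B z : pU z -> hessian LC f z (lft A) (rgt B) =
  pd (lft A) (pd (rgt B) f) z + \sum_C G (pt z) A B C * pd (rgt C) f z.
Proof.
move=> Uz; rewrite hessianE; congr (_ + _); rewrite big_split_ord /=.
rewrite [X in X + _]big1 ?add0r => [|C _]; last by rewrite mpw_christoffel_xxp // mul0r.
by rewrite -sumrN; apply: eq_bigr => C _; rewrite mpw_christoffel_xpp // mulNr opprK.
Qed.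

Lemma mpw_hessian_px f A B z : pU z -> hessian LC f z (rgt A) (lft B) =
  pd (rgt A) (pd (lft B) f) z + \sum_C G (pt z) B A C * pd (rgt C) f z.
Proof.
move=> Uz; rewrite hessianE; congr (_ + _); rewrite big_split_ord /=.
rewrite [X in X + _]big1 ?add0r => [|C _]; last by rewrite mpw_christoffel_pxx // mul0r.
by rewrite -sumrN; apply: eq_bigr => C _; rewrite mpw_christoffel_ppx // mulNr opprK.
Qed.

Lemma mpw_hessian_xx f A B z : pU z -> hessian LC f z (lft A) (lft B) =
  pd (lft A) (pd (lft B) f) z - \sum_C G (pt z) A C B * pd (lft C) f z
  - \sum_C LC z (lft A) (rgt C) (lft B) * pd (rgt C) f z.
Proof.
move=> Uz; rewrite hessianE big_split_ord /= opprD addrA; congr (_ - _ - _).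
by apply: eq_bigr => C _; rewrite mpw_christoffel_xxx.
Qed.

(* Sorting by degree in the momenta, with the tensors replaced by arbitrary
   coefficients. *)
Let collect (c : 'I_n -> R) (M : 'I_n -> 'I_n -> R) (r p : 'I_n -> R) :
  \sum_C c C * (\sum_K M C K * p K + r C) =
  \sum_K (\sum_C c C * M C K) * p K + \sum_C c C * r C.
Proof.
rewrite (eq_bigr (fun C => \sum_K c C * M C K * p K + c C * r C)).
  rewrite big_split /=; congr (_ + _).
  by rewrite exchange_big; apply: eq_bigr => K _; rewrite mulr_suml.
by move=> C _; rewrite mulrDr mulr_sumr; congr (_ + _); apply: eq_bigr => K _; rewrite mulrA.
Qed.

Let lower_christoffel_collect (a1 a2 a3 q p : 'I_n -> R) (f1 f2 f3 s : R) :
  2^-1 * (- 2 * (\sum_K a1 K * p K) + f1 + (- 2 * (\sum_K a2 K * p K) + f2)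
          - (- 2 * (\sum_K a3 K * p K) + f3)) - (- 2 * (\sum_K q K * p K) + s) =
  \sum_K (2 * q K - (a1 K + a2 K - a3 K)) * p K + (2^-1 * (f1 + f2 - f3) - s).
Proof.
rewrite [X in _ = X + _](eq_bigr (fun K => 2 * (q K * p K) - a1 K * p K - a2 K * p K
   + a3 K * p K)) => [|K _]; last by ring.
rewrite big_split !sumrB -mulr_sumr /=.
move: (\sum_K a1 _ * _) (\sum_K a2 _ * _) (\sum_K a3 _ * _) (\sum_K q _ * _).
by move=> a b c d; field.
Qed.

Let hessian_collect (d g1 t xi gk p : 'I_n -> R) (P lam d2 gt rt tau phi : R) :
  \sum_K d K * p K + d2 - (\sum_K g1 K * p K + gt) - (\sum_K t K * p K + rt)
  + P * (\sum_K xi K * p K + tau) - lam * (\sum_K gk K * p K + phi) =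
  \sum_K (d K - g1 K - t K + P * xi K - lam * gk K) * p K
  + (d2 - gt + P * tau - (rt + lam * phi)).
Proof.
rewrite [X in _ = X + _](eq_bigr (fun K => d K * p K - g1 K * p K - t K * p K
   + P * (xi K * p K) - lam * (gk K * p K))) => [|K _]; last by ring.
rewrite sumrB big_split !sumrB -!mulr_sumr /=.
by ring.
Qed.

Let christoffel_xpx_affine A B C z : pU z -> LC z (lft A) (rgt C) (lft B) =
  \sum_K (2 * (\sum_E G (pt z) C K E * G (pt z) A E B)
          - (pd A (fun x => G x B K C) (pt z) + pd B (fun x => G x A K C) (pt z)
             - pd C (fun x => G x A K B) (pt z))) * rsubmx z 0 K
  + (2^-1 * (pd A (fun x => Phi x B C) (pt z) + pd B (fun x => Phi x A C) (pt z)
        - pd C (fun x => Phi x A B) (pt z))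
     - \sum_E G (pt z) A E B * Phi (pt z) C E).
Proof.
move=> Uz; rewrite mpw_christoffel_xpx // !pd_base_block_base //.
have -> : \sum_E S C E z * G (pt z) A E B =
    - 2 * (\sum_K (\sum_E G (pt z) C K E * G (pt z) A E B) * rsubmx z 0 K)
    + \sum_E G (pt z) A E B * Phi (pt z) C E.
  rewrite (eq_bigr (fun E => G (pt z) A E B *
     (\sum_K (- 2 * G (pt z) C K E) * rsubmx z 0 K + Phi (pt z) C E))); last first.
    by move=> E _; rewrite base_blockE mulrC.
  rewrite (collect (fun E => G (pt z) A E B) (fun E K => - 2 * G (pt z) C K E)
    (fun E => Phi (pt z) C E) (fun K => rsubmx z 0 K)); congr (_ + _).
  rewrite mulr_sumr; apply: eq_bigr => K _; rewrite mulrA mulr_sumr; congr (_ * _).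
  by apply: eq_bigr => E _; ring.
exact: (lower_christoffel_collect
  (fun K => pd A (fun x => G x B K C) (pt z)) (fun K => pd B (fun x => G x A K C) (pt z))
  (fun K => pd C (fun x => G x A K B) (pt z))
  (fun K => \sum_E G (pt z) C K E * G (pt z) A E B) (fun K => rsubmx z 0 K)).
Qed.

(** * The almost Einstein equation on the cotangent bundle *)

(** The equation (D_a D_b + P_ab) f = lam g_ab: as the metric has zero scalar
    curvature and dimension n + n, its Schouten tensor is Ric / (2n - 2). *)
Definition einstein_equation (f : 'rV[R]_(n + n) -> R) z : Prop :=
  exists lam, forall a b, hessian LC f z a b
     + ricci LC z a b / ((n + n)%:R - 2) * f z = lam * g z a b.

Section EinsteinEquation.
Context (f : 'rV[R]_(n + n) -> R).
Hypothesis smooth_f : smooth pU f.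
Hypothesis n_ge2 : (2 <= n)%N.

Let einstein_lhs a b z :=
  hessian LC f z a b + ricci LC z a b / ((n + n)%:R - 2) * f z.

Let i0 : 'I_n := Ordinal (leq_trans (isT : (0 < 2)%N) n_ge2).

(* The multiplier can be read off from any pair of dual directions, so that the
   equation becomes the vanishing of smooth functions. *)
Let defect a b z :=
  einstein_lhs a b z - einstein_lhs (lft i0) (rgt i0) z * g z a b.

Let einstein_equation_defect z :
  einstein_equation f z <-> forall a b, defect a b z = 0.
Proof.
split=> [[lam E] a b|E].
  by rewrite /defect /einstein_lhs !E gxp eqxx mulr1 subrr.
by exists (einstein_lhs (lft i0) (rgt i0) z) => a b; apply/eqP; rewrite -subr_eq0; apply/eqP/E.
Qed.

Let smooth_lhs a b : smooth pU (einstein_lhs a b).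
Proof.
apply: smoothD => //; first exact: (smooth_hessian opU a b smooth_mpw_christoffel smooth_f).
apply: smoothM => //; apply: smoothM => //; last exact: smooth_cst.
exact: (smooth_ricci opU a b smooth_mpw_christoffel).
Qed.

Let smooth_defect a b : smooth pU (defect a b).
Proof.
apply: smoothD => //; apply: smoothN => //; apply: smoothM => //.
exact: smooth_mpw_metric.
Qed.

Let defect_vanish V a b z : open V -> V `<=` pU -> (forall y, V y -> f y = 0) ->
  V z -> defect a b z = 0.
Proof.
move=> oV VU f0 Vz.
have d1 c y : V y -> pd c f y = 0.
  by move=> Vy; rewrite (eq_on_open_pd c oV Vy f0) pd_cst.
have h0 a' b' : einstein_lhs a' b' z = 0.
  rewrite /einstein_lhs f0 // mulr0 addr0 hessianE.
  rewrite (eq_on_open_pd _ oV Vz (d1 b')) pd_cst big1 ?subrr // => c _.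
  by rewrite d1 // mulr0.
by rewrite /defect !h0 mul0r subrr.
Qed.

(** The Einstein condition says nothing on the zero set of the scale. If the
    trace-free part were nonzero at some point, it would be so on an open set;
    there f vanishes, since the equation holds where it does not, and then the
    equation holds trivially. *)
Lemma einstein_equation_closure :
  (forall z, pU z -> f z != 0 -> einstein_equation f z) ->
  forall z, pU z -> einstein_equation f z.
Proof.
move=> E z Uz; apply/einstein_equation_defect => a b.
apply/eqP/negP => /negP nz.
(* f vanishes on the open set where the defect does not. *)
have oV := open_neq0 opU (smooth_defect a b).
have : defect a b z = 0; last by move/eqP; exact/negP.
apply: (defect_vanish a b oV); last by split.
  by move=> y [].
move=> y [Uy ny]; apply/eqP/negP => /negP fy; move: ny => /=.
by rewrite ((einstein_equation_defect y).1 (E y Uy fy) a b) eqxx.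
Qed.

Lemma einstein_scaleP :
  einstein_on (pU `&` [set z | f z != 0]) (fun z => (f z) ^- 2 *: g z) <->
  forall z, pU z -> einstein_equation f z.
Proof.
have oV := open_neq0 opU smooth_f.
have VU : pU `&` [set z | f z != 0] `<=` pU by move=> y [].
have n2 : (2 < n + n)%N by rewrite -[2%N]/((1 + 1)%N) -addSn leq_add // (leq_trans _ n_ge2).
have ptP z : (pU `&` [set z | f z != 0]) z -> _ := fun Vz => einstein_conformalP oV
  (fun a b => sub_smooth VU (@smooth_mpw_metric a b))
  (fun a b => sub_smooth VU (@smooth_mpw_inverse a b))
  (fun z a b Vz => @sym_mpw_metric z a b (VU z Vz)) (fun z _ => unit_mpw_metric z)
  (sub_smooth VU smooth_f) (fun z Vz => Vz.2) n2 Vz.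
split=> [E|E z Vz]; last exact/(ptP z Vz)/E/VU.
apply: einstein_equation_closure => z Uz fz.
have Vz : (pU `&` [set z | f z != 0]) z by split.
exact/(ptP z Vz)/E.
Qed.

(** The (p_A, p_B)-component of the metric, of its Ricci tensor and of all its
    Christoffel symbols vanishes, so that component of the equation says that the
    second fibre derivatives of f are zero. *)
Lemma einstein_equation_fibre_affine x p : U x ->
  (forall z, pU z -> einstein_equation f z) ->
  f (row_mx x p) =
  \sum_K pd (rgt K) f (row_mx x 0) * p 0 K + f (row_mx x 0).
Proof.
move=> Ux E.
have sp := smooth_fibre Ux smooth_f.
have -> : \sum_K pd (rgt K) f (row_mx x 0) * p 0 K =
  \sum_K pd K (fun q => f (row_mx x q)) 0 * p 0 K.
  by apply: eq_bigr => K _; rewrite pd_fibre.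
apply: (affine_of_pd2 (f := fun q => f (row_mx x q))) => // A B q.
have Uq : pU (row_mx x q) by rewrite /cotangent_over /= row_mxKl.
have -> : pd B (fun q' => f (row_mx x q')) = fun q' => pd (rgt B) f (row_mx x q').
  by apply/funext => q'; rewrite pd_fibre.
rewrite pd_fibre -mpw_hessian_pp //.
have [lam /(_ (rgt A) (rgt B))] := E _ Uq.
by rewrite mpw_ricci_pp // gpp !mul0r mulr0 addr0.
Qed.

End EinsteinEquation.

Section AffineScale.
Context (xi : 'rV[R]_n -> 'rV[R]_n) (tau : 'rV[R]_n -> R).
Context (sigma : 'rV[R]_(n + n) -> R).
Hypothesis smooth_xi : forall A, smooth U (fun x => xi x 0 A).
Hypothesis smooth_tau : smooth U tau.
Hypothesis sigmaE : forall z, pU z ->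
  sigma z = \sum_K xi (pt z) 0 K * rsubmx z 0 K + tau (pt z).
Hypothesis n_ge2 : (2 <= n)%N.
Hypothesis ricci_sym : forall x A B, U x -> ricci G x A B = ricci G x B A.

(** Normalized by the dimension: the value of the multiplier, as fixed by the
    mixed components. *)
Definition divergence x : R := n%:R^-1 * \sum_K nabla_vec G xi x K K.

Let pd_sigma_fibre C z : pU z -> pd (rgt C) sigma z = xi (pt z) 0 C.
Proof.
move=> Uz; rewrite (eq_on_open_pd _ opU Uz sigmaE).
exact: (pd_affine_fibre C smooth_xi smooth_tau Uz).
Qed.

Let pd_sigma_base C z : pU z -> pd (lft C) sigma z =
  \sum_K pd C (fun x => xi x 0 K) (pt z) * rsubmx z 0 K + pd C tau (pt z).
Proof.
move=> Uz; rewrite (eq_on_open_pd _ opU Uz sigmaE).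
exact: (pd_affine_base C smooth_xi smooth_tau Uz).
Qed.

Lemma hessian_affine_pp A B z : pU z -> hessian LC sigma z (rgt A) (rgt B) = 0.
Proof.
move=> Uz; rewrite mpw_hessian_pp // (eq_on_open_pd _ opU Uz (pd_sigma_fibre B)).
exact: (pd_lsubmx0 (fun x => xi x 0 B)).
Qed.

Lemma hessian_affine_xp A B z : pU z ->
  hessian LC sigma z (lft A) (rgt B) = nabla_vec G xi (pt z) A B.
Proof.
move=> Uz; rewrite mpw_hessian_xp // (eq_on_open_pd _ opU Uz (pd_sigma_fibre B)).
rewrite (pd_lsubmx (fun x => xi x 0 B)) /nabla_vec; congr (_ + _).
by apply: eq_bigr => C _; rewrite pd_sigma_fibre.
Qed.

Lemma hessian_affine_px A B z : pU z ->
  hessian LC sigma z (rgt A) (lft B) = nabla_vec G xi (pt z) B A.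
Proof.
move=> Uz; rewrite mpw_hessian_px // (eq_on_open_pd _ opU Uz (pd_sigma_base B)).
have sdx C : smooth U (pd B (fun x => xi x 0 C)) by exact/smooth_pd/smooth_xi.
rewrite (pd_affine_fibre A sdx (smooth_pd B smooth_tau) Uz) /nabla_vec.
by congr (_ + _); apply: eq_bigr => C _; rewrite pd_sigma_fibre.
Qed.

(** The symmetrized covariant derivatives of Phi collapse: four of the six
    connection terms cancel in pairs, the other two add up. *)
Lemma operF_christoffel x A B : U x -> operF G xi Phi x A B =
  \sum_C xi x 0 C *
    (2^-1 * (pd A (fun y => Phi y B C) x + pd B (fun y => Phi y A C) x
        - pd C (fun y => Phi y A B) x) - \sum_E G x A E B * Phi x C E)
  + divergence x * Phi x A B.
Proof.
move=> Ux; rewrite /operF; congr (_ + _); apply: eq_bigr => C _; congr (_ * _).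
rewrite /nabla_cotensor2.
have -> : \sum_E G x B E A * Phi x E C = \sum_E G x A E B * Phi x C E.
  by apply: eq_bigr => E _; rewrite (sym_G B E A Ux) (sym_Phi E C Ux).
have -> : \sum_E G x A E B * Phi x E C = \sum_E G x A E B * Phi x C E.
  by apply: eq_bigr => E _; rewrite (sym_Phi E C Ux).
have -> : \sum_E G x A E C * Phi x B E = \sum_E G x C E A * Phi x E B.
  by apply: eq_bigr => E _; rewrite (sym_G A E C Ux) (sym_Phi B E Ux).
have -> : \sum_E G x B E C * Phi x A E = \sum_E G x C E B * Phi x A E.
  by apply: eq_bigr => E _; rewrite (sym_G B E C Ux).
move: (pd A _ _) (pd B _ _) (pd C _ _) (\sum_E G x A E B * _).
move: (\sum_E G x C E A * _) (\sum_E G x C E B * _) => a b c d e f.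
by field.
Qed.

(** The horizontal component is affine in the momenta; its constant part is
    the equation on tau. *)
Lemma hessian_affine_xx A B z : pU z ->
  hessian LC sigma z (lft A) (lft B) + proj_schouten G (pt z) A B * sigma z
    - divergence (pt z) * S A B z =
  \sum_K momentum_coef G xi divergence (pt z) A B K * rsubmx z 0 K
  + (hessian G tau (pt z) A B + proj_schouten G (pt z) A B * tau (pt z)
     - operF G xi Phi (pt z) A B).
Proof.
move=> Uz; rewrite mpw_hessian_xx // (eq_on_open_pd _ opU Uz (pd_sigma_base B)).
have sdx C : smooth U (pd B (fun x => xi x 0 C)) by exact/smooth_pd/smooth_xi.
rewrite (pd_affine_base A sdx (smooth_pd B smooth_tau) Uz).
rewrite (eq_bigr _ (fun C _ => congr1 _ (pd_sigma_base C Uz))).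
rewrite (collect (fun C => G (pt z) A C B) (fun C K => pd C (fun x => xi x 0 K) (pt z))
  (fun C => pd C tau (pt z)) (fun K => rsubmx z 0 K)).
have -> : \sum_C LC z (lft A) (rgt C) (lft B) * pd (rgt C) sigma z =
  \sum_C xi (pt z) 0 C * LC z (lft A) (rgt C) (lft B).
  by apply: eq_bigr => C _; rewrite pd_sigma_fibre // mulrC.
rewrite (eq_bigr _ (fun C _ => congr1 _ (christoffel_xpx_affine A B C Uz))).
rewrite (collect (fun C => xi (pt z) 0 C) _ _ (fun K => rsubmx z 0 K)).
rewrite operF_christoffel // (hessianE G) sigmaE // base_blockE.
set x := pt z; set p := fun K => rsubmx z 0 K.
have E K : momentum_coef G xi divergence x A B K =
  pd A (pd B (fun y => xi y 0 K)) x
  - \sum_C G x A C B * pd C (fun y => xi y 0 K) x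
  - \sum_C xi x 0 C * (2 * (\sum_E G x C K E * G x A E B) -
     (pd A (fun y => G y B K C) x + pd B (fun y => G y A K C) x
            - pd C (fun y => G y A K B) x))
  + proj_schouten G x A B * xi x 0 K - divergence x * (- 2 * G x A K B).
  rewrite /momentum_coef.
  have -> : \sum_C xi x 0 C * (2 * (\sum_E G x C K E * G x A E B) -
     (pd A (fun y => G y B K C) x + pd B (fun y => G y A K C) x
            - pd C (fun y => G y A K B) x)) =
     2 * (\sum_C (\sum_E G x C K E * G x A E B) * xi x 0 C) -
     \sum_C (pd A (fun y => G y B K C) x + pd B (fun y => G y A K C) x
            - pd C (fun y => G y A K B) x) * xi x 0 C.
    by rewrite mulr_sumr -sumrB; apply: eq_bigr => C _; ring.
  move: (pd A _ _) (\sum_C _) (\sum_C _) (\sum_C _) (proj_schouten _ _ _ _).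
  by move: (divergence x) => a b c d e f; ring.
rewrite (eq_bigr _ (fun K _ => congr1 (fun t => t * p K) (E K))).
exact: hessian_collect.
Qed.

Let n_neq0 : n%:R != 0 :> R.
Proof. by rewrite pnatr_eq0 -lt0n (leq_trans _ n_ge2). Qed.

Let ricci_schouten A B x : U x ->
  (ricci G x A B + ricci G x B A) / ((n + n)%:R - 2) = proj_schouten G x A B.
Proof.
move=> Ux; have n1 : n%:R - 1 != 0 :> R by rewrite subr_eq0 (eqr_nat R n 1) gtn_eqF.
have n1' : 2 * (n%:R - 1) != 0 :> R by rewrite mulf_neq0 // pnatr_eq0.
have E : (n + n)%:R - 2 = 2 * (n%:R - 1) :> R by rewrite natrD; ring.
rewrite (ricci_sym B A Ux) /proj_schouten E.
move: (ricci _ _ _ _) (n%:R) n1 n1' => r N n1 n1'.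
by field.
Qed.

(** Componentwise: the vertical block is vacuous, the mixed blocks say that the
    derivative of xi is pure trace and fix the multiplier. *)
Lemma einstein_equation_affine z : pU z -> einstein_equation sigma z <->
  (forall A B, nabla_vec G xi (pt z) A B = divergence (pt z) * (A == B)%:R) /\
  (forall A B, hessian LC sigma z (lft A) (lft B)
     + proj_schouten G (pt z) A B * sigma z - divergence (pt z) * S A B z = 0).
Proof.
move=> Uz; split=> [[lam E]|[E1 E2]].
  have E1 A B : nabla_vec G xi (pt z) A B = lam * (A == B)%:R.
    have := E (lft A) (rgt B).
    by rewrite hessian_affine_xp // mpw_ricci_xp // gxp mul0r mul0r addr0.
  have lamE : divergence (pt z) = lam.
    rewrite /divergence (eq_bigr (fun=> lam)) => [|K _].
      by rewrite sumr_const card_ord -[lam *+ n]mulr_natl mulKf.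
    by rewrite E1 eqxx mulr1.
  rewrite lamE; split=> // A B; have := E (lft A) (lft B).
  by rewrite mpw_ricci_xx // ricci_schouten // gxx => ->; rewrite subrr.
exists (divergence (pt z)) => a b.
case: (split_ordP a) => A ->; case: (split_ordP b) => B ->.
- rewrite mpw_ricci_xx // ricci_schouten // gxx.
  by apply/eqP; rewrite -subr_eq0 E2.
- by rewrite hessian_affine_xp // mpw_ricci_xp // gxp !mul0r addr0 E1.
- by rewrite hessian_affine_px // mpw_ricci_px // gpx !mul0r addr0 E1 eq_sym.
- by rewrite hessian_affine_pp // mpw_ricci_pp // gpp !mul0r mulr0 addr0.
Qed.

Lemma smooth_divergence : smooth U divergence.
Proof.
apply: smoothM => //; first exact: smooth_cst.
apply: smooth_sum => // K; apply: smoothD => //; first exact/smooth_pd/smooth_xi.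
by apply: smooth_sum => // C; exact: smoothM.
Qed.

(** The horizontal component holds for all momenta iff all its coefficients
    vanish; once the derivative of xi is pure trace on an open set, the linear
    ones are contractions of xi with the Weyl tensor. *)
Lemma einstein_affineP : (forall z, pU z -> einstein_equation sigma z) <->
  (forall x, U x -> forall B C E,
     \sum_K xi x 0 K * proj_weyl G x K B C E = 0) /\
  (forall x, U x -> forall A B, tracefree_nabla_vec G xi x A B = 0) /\
  (forall x, U x -> forall A B,
     hessian G tau x A B + proj_schouten G x A B * tau x = operF G xi Phi x A B).
Proof.
have tfE x A B : tracefree_nabla_vec G xi x A B =
    nabla_vec G xi x A B - divergence x * (A == B)%:R by [].
have coefE x : U x -> (forall y A B, U y ->
      nabla_vec G xi y A B = divergence y * (A == B)%:R) -> forall A B K,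
    momentum_coef G xi divergence x A B K =
    - \sum_C xi x 0 C * proj_weyl G x C B K A.
  move=> Ux N A B K.
  apply: (momentum_coefE oU smooth_G sym_G smooth_xi smooth_divergence N A B K n_ge2 Ux).
  by move=> C E; exact: ricci_sym.
split=> [E|[W [T H]]].
- have pE x p : U x -> einstein_equation sigma (row_mx x p).
    by move=> Ux; apply: E; rewrite /cotangent_over /= row_mxKl.
  have pUx x p : U x -> pU (row_mx x p).
    by rewrite /cotangent_over /= row_mxKl.
  have N y A B : U y -> nabla_vec G xi y A B = divergence y * (A == B)%:R.
    move=> Uy; have [+ _] := (einstein_equation_affine (pUx _ 0 Uy)).1 (pE _ 0 Uy).
    by rewrite row_mxKl; apply.
  have L x (p : 'rV[R]_n) A B : U x -> \sum_K momentum_coef G xi divergence x A B K * p 0 K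
     + (hessian G tau x A B + proj_schouten G x A B * tau x
        - operF G xi Phi x A B) = 0.
    move=> Ux; have [_ +] := (einstein_equation_affine (pUx _ p Ux)).1 (pE _ p Ux).
    by move=> /(_ A B); rewrite hessian_affine_xx ?row_mxKl ?row_mxKr //; exact: pUx.
  have L0 x A B : U x -> hessian G tau x A B + proj_schouten G x A B * tau x
        - operF G xi Phi x A B = 0.
    move=> Ux; have := L x 0 A B Ux; rewrite big1 ?add0r // => K _.
    by rewrite mxE mulr0.
  split; [|split].
  + move=> x Ux B C E'; have := L x (delta_mx 0 C) E' B Ux.
    rewrite L0 // addr0 (eq_bigr (fun K => (K == C)%:R *
      momentum_coef G xi divergence x E' B K)); last first.
      by move=> K _; rewrite mxE eqxx mulrC.
    by rewrite sum_delta coefE // => /eqP; rewrite oppr_eq0 => /eqP.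
  + by move=> x Ux A B; rewrite tfE N // subrr.
  + by move=> x Ux A B; apply/eqP; rewrite -subr_eq0 L0.
have N y A B : U y -> nabla_vec G xi y A B = divergence y * (A == B)%:R.
  by move=> Uy; apply/eqP; rewrite -subr_eq0 -tfE T.
move=> z Uz; apply/(einstein_equation_affine Uz); split=> A B; first exact: N.
rewrite hessian_affine_xx // H // subrr addr0 big1 // => K _.
by rewrite coefE // W // oppr0 mul0r.
Qed.

End AffineScale.

End PattersonWalker.

(** * Parallel volume forms *)

Section ParallelVolume.
Context {R : realType} {n : nat} (U : set 'rV[R]_n) (oU : open U).
Context (G : christoffel R n) (w : 'rV[R]_n -> R).
Hypothesis smooth_G : forall A C B, smooth U (fun x => G x A C B).
Hypothesis sym_G : forall x A C B, U x -> G x A C B = G x B C A.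
Hypothesis smooth_w : smooth U w.
Hypothesis w_neq0 : forall x, U x -> w x != 0.
Hypothesis parallel_w : forall x A, U x ->
  pd A w x - (\sum_B G x A B B) * w x = 0.

(** The trace of the connection is the logarithmic gradient of the volume, hence
    closed, and the skew part of Ric is a multiple of its exterior derivative. *)
Lemma ricci_sym_of_parallel x B E : U x -> ricci G x B E = ricci G x E B.
Proof.
move=> Ux.
have tr y k : U y -> \sum_A G y A A k = pd k w y / w y.
  move=> Uy; have /eqP := parallel_w k Uy; rewrite subr_eq0 => /eqP ->.
  rewrite mulfK ?w_neq0 //; apply: eq_bigr => A _; exact: sym_G.
have dtr i k : \sum_A pd i (fun y => G y A A k) x =
    pd i (pd k w) x / w x - pd k w x * pd i w x / w x ^+ 2.
  rewrite -(pd_sum oU _ _ Ux (fun A => smooth_G A A k)).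
  rewrite (eq_on_open_pd _ oU Ux (fun y Uy => tr y k Uy)).
  have sV : smooth U (fun y => (w y)^-1) by exact: smoothV.
  rewrite (pdM _ Ux (smooth_pd k smooth_w) sV) (pdV _ Ux) ?w_neq0 //.
  by rewrite mulNr mulrN mulrA.
have tr_sym : \sum_A pd B (fun y => G y A A E) x = \sum_A pd E (fun y => G y A A B) x.
  apply: etrans (dtr B E) (etrans _ (esym (dtr E B))).
  by rewrite (pdC B E oU smooth_w Ux) [pd E w x * _]mulrC.
rewrite /ricci /curvature !big_split /= !sumrN tr_sym; congr (_ - _ + _).
  apply: eq_bigr => A _; apply: (eq_on_open_pd _ oU Ux) => y Uy; exact: sym_G.
under eq_bigr do rewrite sumrB; under [RHS]eq_bigr do rewrite sumrB.
rewrite !sumrB; congr (_ - _).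
  by apply: eq_bigr => A _; apply: eq_bigr => K _; rewrite (sym_G B K E Ux).
rewrite exchange_big; apply: eq_bigr => A _; apply: eq_bigr => K _.
by rewrite mulrC (sym_G B K A Ux) (sym_G K A E Ux).
Qed.

End ParallelVolume.

(** * Passage from charts to the manifold *)

Section Charts.
Context {R : realType} {n : nat} (M : oriented_manifold R n).

Lemma overlap_chart_img (i j : chart_idx M) x : overlap i j x ->
  chart_img i x /\ chart_img j (transition i j x).
Proof.
move=> [a [ia ja] <-]; split; first by exists a.
by exists a => //; rewrite /transition /= chartK.
Qed.

Lemma modified_pw_metricE (D : affine_connection M) (Phi : sym_cotensor2 M) i :
  modified_pw_metric D Phi i = mpw_metric (D i) (Phi i).
Proof.
apply/funext => z; rewrite /modified_pw_metric /pw_metric add_block_mx !addr0.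
by congr block_mx; apply/matrixP => A B; rewrite !mxE.
Qed.

Context (D : affine_connection M) (Phi : sym_cotensor2 M) (sigma : cotangent_function M).
Hypothesis n_ge2 : (2 <= n)%N.
Hypothesis D_torsion_free : torsion_free D.

Let oU i : open (chart_img i : set 'rV[R]_n) := @chart_img_open R n M i.

Let sym_D i x A C B : chart_img i x -> D i x A C B = D i x B C A.
Proof. by move=> Ux; exact: D_torsion_free. Qed.

Let sym_Phi i x A B : chart_img i x -> Phi i x A B = Phi i x B A.
Proof. by move=> Ux; rewrite -[in LHS](cot2_sym Phi Ux) mxE. Qed.

Lemma almost_einstein_equation :
  almost_einstein_scale (modified_pw_metric D Phi) sigma <->
  forall i z, cotangent_over (chart_img i) z ->
    einstein_equation (D i) (Phi i) (sigma i) z.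
Proof.
have P i := einstein_scaleP (@oU i) (conn_smooth D i) (cot2_smooth Phi i)
  (@sym_D i) (@sym_Phi i) (cotf_smooth sigma i) n_ge2.
split=> E i.
  by apply/(P i); have := E i; rewrite modified_pw_metricE.
by rewrite modified_pw_metricE; apply/(P i)/E.
Qed.

Lemma chart_einstein_affineP (xi : vector_field M) (tau : scalar_field M) i :
  (forall x A B, chart_img i x -> ricci (D i) x A B = ricci (D i) x B A) ->
  (forall x p, chart_img i x ->
     sigma i (row_mx x p) = \sum_(K < n) xi i x 0 K * p 0 K + tau i x) ->
  (forall z, cotangent_over (chart_img i) z ->
     einstein_equation (D i) (Phi i) (sigma i) z) <->
  (forall x, chart_img i x -> forall B C E : 'I_n,
     \sum_(K < n) xi i x 0 K * proj_weyl (D i) x K B C E = 0) /\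
  (forall x, chart_img i x -> forall A B : 'I_n,
     tracefree_nabla_vec (D i) (xi i) x A B = 0) /\
  (forall x, chart_img i x -> forall A B : 'I_n,
     hessian (D i) (tau i) x A B + proj_schouten (D i) x A B * tau i x =
     operF (D i) (xi i) (Phi i) x A B).
Proof.
move=> ricS sE.
apply: (einstein_affineP (@oU i) (conn_smooth D i) (cot2_smooth Phi i)
  (@sym_D i) (@sym_Phi i) (vec_smooth xi i) (scal_smooth tau i) _ n_ge2 ricS).
by move=> z Uz; rewrite -[in LHS](hsubmxK z) sE.
Qed.

Section FibreAffine.
Hypothesis sigma_einstein : forall i z, cotangent_over (chart_img i) z ->
  einstein_equation (D i) (Phi i) (sigma i) z.

(** The fibre derivatives of sigma are constant along the fibres; the zero
    section provides a point at which to evaluate them. *)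
Definition momentum_field i x : 'rV[R]_n :=
  \row_K pd (rshift n K) (sigma i) (row_mx x 0).

Definition zero_section_value i x : R := sigma i (row_mx x 0).

Lemma sigma_fibre_affine i x p : chart_img i x -> sigma i (row_mx x p) =
  \sum_K momentum_field i x 0 K * p 0 K + zero_section_value i x.
Proof.
move=> Ux.
rewrite (einstein_equation_fibre_affine (@oU i) (conn_smooth D i) (cot2_smooth Phi i)
  (@sym_D i) (cotf_smooth sigma i) p Ux (sigma_einstein (i := i))).
by congr (_ + _); apply: eq_bigr => K _; rewrite mxE.
Qed.

Lemma momentum_field_smooth i : smooth_vmap (chart_img i) (momentum_field i).
Proof.
move=> K.
apply: (eq_smooth (f := fun x => pd (rshift n K) (sigma i) (row_mx x 0))) => //.
  by move=> x _; rewrite mxE.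
by apply: smooth_base; apply: smooth_pd; exact: cotf_smooth.
Qed.

Lemma zero_section_value_smooth i : smooth (chart_img i) (zero_section_value i).
Proof. by apply: smooth_base; exact: cotf_smooth. Qed.

Lemma zero_section_value_compat i j x : overlap i j x ->
  zero_section_value i x = zero_section_value j (transition i j x).
Proof.
by move=> /(cotf_compat sigma 0); rewrite mul0mx.
Qed.

(** Test the two fibrewise affine expressions of sigma on the coordinate
    covectors of chart j, transported to chart i. *)
Lemma momentum_field_compat i j x : overlap i j x ->
  momentum_field j (transition i j x) = momentum_field i x *m transJ i j x.
Proof.
move=> ijx; have [Ux Ux'] := overlap_chart_img ijx.
apply/rowP => B; rewrite [RHS]mxE.
have := cotf_compat sigma (delta_mx 0 B) ijx.
rewrite !sigma_fibre_affine // (zero_section_value_compat ijx) => /addIr.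
rewrite [RHS](eq_bigr (fun K => (K == B)%:R * momentum_field j (transition i j x) 0 K)).
  rewrite sum_delta => <-; apply: eq_bigr => K _; congr (_ * _).
  rewrite mxE (eq_bigr (fun L => (L == B)%:R * transJ i j x K L)) ?sum_delta //.
  by move=> L _; rewrite !mxE eqxx.
by move=> K _; rewrite [delta_mx _ _ _ _]mxE eqxx mulrC.
Qed.

Definition momentum_vector_field : vector_field M :=
  VectorField momentum_field_smooth momentum_field_compat.

Definition zero_section_field : scalar_field M :=
  ScalarField zero_section_value_smooth zero_section_value_compat.

End FibreAffine.
End Charts.

Theorem proposition3p1 (R : realType) (n : nat) (hn : (2 <= n)%N)
    (M : oriented_manifold R n) (D : affine_connection M)
    (D_torsion_free : torsion_free D) (D_special : special D)
    (Phi : sym_cotensor2 M) (sigma : cotangent_function M) :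
  almost_einstein_scale (modified_pw_metric D Phi) sigma <->
  exists (xi : vector_field M) (tau : scalar_field M),
    (forall i x p, chart_img i x ->
       sigma i (row_mx x p) = \sum_(K < n) xi i x 0 K * p 0 K + tau i x) /\
    (forall i x, chart_img i x -> forall B C E : 'I_n,
       \sum_(K < n) xi i x 0 K * proj_weyl (D i) x K B C E = 0) /\
    (forall i x, chart_img i x -> forall A B : 'I_n,
       tracefree_nabla_vec (D i) (xi i) x A B = 0) /\
    (forall i x, chart_img i x -> forall A B : 'I_n,
       hessian (D i) (tau i) x A B + proj_schouten (D i) x A B * tau i x =
       operF (D i) (xi i) (Phi i) x A B).
Proof.
have ricS i x A B : chart_img i x -> ricci (D i) x A B = ricci (D i) x B A.
  have [vol vol_par] := D_special.
  apply: (ricci_sym_of_parallel (@chart_img_open _ _ M i) (conn_smooth D i)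
    (fun x A C B Ux => D_torsion_free i x Ux A C B) (vol_smooth vol i) (@vol_neq0 _ _ _ vol i)).
  by move=> y C Uy; exact: vol_par.
apply: (iff_trans (almost_einstein_equation Phi sigma hn D_torsion_free)).
split=> [E|[xi [tau [sE [W [T H]]]]] i].
  exists (momentum_vector_field D_torsion_free E).
  exists (zero_section_field sigma).
  have sE i x p : chart_img i x -> sigma i (row_mx x p) =
      \sum_(K < n) momentum_vector_field D_torsion_free E i x 0 K * p 0 K
      + zero_section_field sigma i x.
    by move=> Ux; exact: (sigma_fibre_affine D_torsion_free E p Ux).
  split; first exact: sE.
  have P i := (chart_einstein_affineP Phi hn D_torsion_free (ricS i) (sE i)).1 (E i).
  split; [|split] => i; have [W [T H]] := P i; [exact: W|exact: T|exact: H].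
apply/(chart_einstein_affineP Phi hn D_torsion_free (ricS i) (sE i)).
by split; [exact: W|split; [exact: T|exact: H]].
Qed.
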